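(* Let $k\in\{4,5\}$. There is $n_0$ such that for every $n\ge n_0$ the following holds. If $G\in{\rm SPEX}(n,W_{2k+1})$, then there are a number $s$ with $|s|\le 1$ and a partition $V(G)=L\cup R$ with $|L|=\frac n2+s$ and $|R|=\frac n2-s$ such that: \begin{itemize} \item every vertex of $L$ is adjacent to every vertex of $R$; \item $G[L]\in\mathcal U_{k,\frac n2+s}$; \item $G[R]$ has exactly one edge. \end{itemize}
   Context: For $k\ge 4$, the wheel $W_k=K_1\vee C_{k-1}$ is the graph obtained from a cycle on $k-1$ vertices by adding one new vertex adjacent to all vertices of the cycle. Thus $W_{2k+1}$ (with $k\ge2$) is the odd wheel obtained from $C_{2k}$ by adding a vertex adjacent to all its vertices. The spectral radius $\lambda_1(G)$ is the largest eigenvalue of the adjacency matrix of $G$. A graph is $F$-free if it contains no subgraph isomorphic to $F$. ${\rm SPEX}(n,F)$ denotes the set of $F$-free graphs on $n$ vertices with maximum spectral radius. A graph is nearly $(k-1)$-regular if every vertex has degree $k-1$ except exactly one vertex, which has degree $k-2$. For $k\ge3$ and integer $m$, $\mathcal U_{k,m}$ denotes the family of graphs on $m$ vertices that are $(k-1)$-regular or nearly $(k-1)$-regular and contain no path on $2k-1$ vertices. Equivalently, these are the $(k-1)$-regular or nearly $(k-1)$-regular graphs on $m$ vertices in which every connected component has at most $2k-2$ vertices. *)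

(* Defs.v *)
From HB Require Import structures.
From mathcomp Require Import all_boot all_order all_algebra.
From mathcomp Require Import reals.
Set Implicit Arguments. Unset Strict Implicit. Unset Printing Implicit Defensive.
Import Order.TTheory GRing.Theory Num.Theory.

Definition simple_graph (n : nat) (G : rel 'I_n) : Prop :=
  symmetric G /\ irreflexive G.

Definition contains_in (p n : nat) (F : rel 'I_p) (G : rel 'I_n) (L : {set 'I_n}) : Prop :=
  exists f : 'I_p -> 'I_n,
    injective f /\ (forall x, f x \in L) /\ (forall x y, F x y -> G (f x) (f y)).

Definition contains (p n : nat) (F : rel 'I_p) (G : rel 'I_n) : Prop :=
  contains_in F G setT.

Definition free (p n : nat) (F : rel 'I_p) (G : rel 'I_n) : Prop := ~ contains F G.

(* The wheel W_k = K_1 v C_{k-1} on vertex set 'I_k: vertex 0 is the hub,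
   vertices 1..k-1 form the cycle 1-2-...-(k-1)-1. *)
Definition wheel (k : nat) : rel 'I_k :=
  fun x y =>
    (x != y) &&
    ( ((val x == 0%N) && (val y != 0%N))
   || ((val y == 0%N) && (val x != 0%N))
   || ((0 < val x)%N && (0 < val y)%N &&
        ( (val x == (val y).+1) || (val y == (val x).+1)
       || ((val x == 1%N) && (val y == k.-1))
       || ((val y == 1%N) && (val x == k.-1))))).

Definition path_graph (p : nat) : rel 'I_p :=
  fun x y => (val x == (val y).+1) || (val y == (val x).+1).

Definition adj_mx (R : realType) (n : nat) (G : rel 'I_n) : 'M[R]_n :=
  \matrix_(i, j) ((G i j)%:R)%R.

Definition lambda1 (R : realType) (n : nat) (G : rel 'I_n) : R :=
  sup (fun mu : R => eigenvalue (adj_mx R G) mu : Prop).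

Definition SPEX (R : realType) (p n : nat) (F : rel 'I_p) (G : rel 'I_n) : Prop :=
  simple_graph G /\ free F G /\
  forall H : rel 'I_n, simple_graph H -> free F H -> (lambda1 R H <= lambda1 R G)%R.

Definition deg_in (n : nat) (G : rel 'I_n) (L : {set 'I_n}) (x : 'I_n) : nat :=
  #|[set y in L | G x y]|.

Definition in_U (n : nat) (G : rel 'I_n) (L : {set 'I_n}) (k m : nat) : Prop :=
  #|L| = m /\
  ((forall x, x \in L -> deg_in G L x = k.-1) \/
   (exists v, v \in L /\ deg_in G L v = k.-2 /\
      forall x, x \in L -> x != v -> deg_in G L x = k.-1)) /\
  ~ contains_in (@path_graph (2 * k - 1)) G L.

Definition edges_in (n : nat) (G : rel 'I_n) (R : {set 'I_n}) : nat :=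
  #|[set e : 'I_n * 'I_n | (e.1 \in R) && (e.2 \in R) && G e.1 e.2 && (e.1 < e.2)%N]|.

(* Main.v *)
Require Import Defs.
From HB Require Import structures.
From mathcomp Require Import all_boot all_order all_algebra.
From mathcomp Require Import reals.
From mathcomp Require boolp classical_sets topology normedtype derive.
From mathcomp Require Import zify ring lra.
Set Implicit Arguments. Unset Strict Implicit. Unset Printing Implicit Defensive.
Import Order.TTheory GRing.Theory Num.Theory.
Local Open Scope ring_scope.

(* Let [lam] be the spectral radius of [G] and [x] its Perron vector, with
   maximal entry [x u = 1]. Since [N(u)] contains no [K_{k,k}], counting 2-walks
   from [u] gives [lam ^ 2 <= \sum_(w notin N(u)) |N(w) :&: N(u)| x_w + o(n ^ 2)].
   As [lam >= n / 2], almost all pairs between [N(u)] and its complement are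
   edges. Rewiring a vertex to a set of typical vertices creates no wheel, so
   extremality keeps every entry of [x] near 1; this gives a partition [L, R] of
   the vertices in which a vertex has at most [k - 1] neighbours on its own side
   and misses at most as many on the other side.

   If inner degrees are at most [a] in [L] and [b] in [R], summing the eigenvalue
   equation over each side gives [(lam - a) (lam - b) <= |L| |R| <= n ^ 2 / 4]. On the
   other hand comparison with a graph of the stated form shows that [lam ^ 2 - (k - 1) lam]
   exceeds [n ^ 2 / 4 + 9 / 10], the excess coming from its edge inside [R]. If
   both sides contain many edges, then embedding wheels forces [a + b <= k - 1],
   possibly with equality: [(2, 1)] for [k = 4] and [(3, 1)], [(2, 2)] for
   [k = 5]. Either way this is a contradiction. So one side, [R], has few edges,
   almost all vertices of [L] have degree [k - 1] in [L], hence [R] has at most one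
   edge, and the exact identity [master_identity] settles the rest. *)

(** * Spectral radius and Perron vector *)

Section Compactness.
Import boolp classical_sets topology normedtype derive.
Import numFieldNormedType.Exports.
Local Open Scope classical_set_scope.

Lemma continuous_sum (R : realType) (n : nat) (T : topologicalType)
    (F : 'I_n -> T -> R) :
  (forall i, continuous (F i)) -> continuous (fun x => \sum_i F i x).
Proof.
by move=> cF; exact: (@continuous_big R 'I_n +%R 0 xpredT (@add_continuous R)).
Qed.

(** The unit sphere is closed inside the compact cube [[-1, 1]^n], so the extreme value theorem
    applies; [0 < n] makes the sphere nonempty. *)
Lemma exists_max_on_sphere (R : realType) (n : nat) (f : 'rV[R]_n -> R) :
  (0 < n)%N -> continuous f ->
  exists x : 'rV[R]_n, \sum_i x 0 i ^+ 2 = 1 /\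
    forall y : 'rV[R]_n, \sum_i y 0 i ^+ 2 = 1 -> f y <= f x.
Proof.
move=> n_gt0 cf.
pose S := [set x : 'rV[R]_n | \sum_i x 0 i ^+ 2 = 1].
have cS : compact S.
  have cC := @rV_compact R n (fun=> `[(- 1)%R, 1%R]) (fun=> @segment_compact R _ _).
  apply: (subclosed_compact _ cC).
    have -> : S = (fun x : 'rV[R]_n => \sum_i x 0 i ^+ 2) @^-1` [set 1] by [].
    have /continuous_closedP : continuous (fun x : 'rV[R]_n => \sum_i x 0 i ^+ 2).
      apply: continuous_sum => i x; have cx := @coord_continuous R 1 n 0 i x.
      exact: (cvgM cx cx).
    apply; exact: closed_eq.
  move=> v Sv i /=; rewrite in_itv /= -ler_norml.
  have : v ord0 i ^+ 2 <= 1.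
    by rewrite -Sv (bigD1 i) //= lerDl sumr_ge0 // => j _; rewrite sqr_ge0.
  by move=> v2; rewrite -(@ler_pXn2r R 2) ?nnegrE ?expr1n ?real_normK ?num_real.
have [|x /set_mem Sx mx] := EVT_max_rV _ cS (continuous_subspaceT cf).
  pose i0 := Ordinal n_gt0.
  exists (delta_mx 0 i0); rewrite /S /= (bigD1 i0) //= big1 => [|i /negPf ni].
    by rewrite mxE !eqxx expr1n addr0.
  by rewrite mxE ni andbF expr0n.
by exists x; split => // y Sy; apply: mx; apply/mem_set.
Qed.

Lemma quadratic_form_continuous (R : realType) (n : nat) (A : 'M[R]_n) :
  continuous (fun x : 'rV[R]_n => \sum_i \sum_j x 0 i * A i j * x 0 j).
Proof.
apply: continuous_sum => i; apply: continuous_sum => j x.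
have cxi := @coord_continuous R 1 n 0 i x.
have cxj := @coord_continuous R 1 n 0 j x.
exact: (cvgM (cvgM cxi (cvg_cst (A i j))) cxj).
Qed.
End Compactness.

Section Spectral.
Variables (R : realType) (n : nat).
Implicit Types (G H : rel 'I_n) (x y : 'I_n -> R) (v : 'I_n).

Definition adj_sum G x i : R := \sum_(j | G i j) x j.
Definition qform G x : R := \sum_i x i * adj_sum G x i.
Definition sqnorm x : R := \sum_i x i ^+ 2.
Definition update x v (t : R) : 'I_n -> R := fun i => if i == v then t else x i.

(** Isolates the dependence on the coordinate at [v]: by symmetry each edge at [v] counts twice, and
    without loops the form is affine in [x v]. One-coordinate perturbations and rewiring at [v] both
    rest on this. *)
Lemma qform_split G x v : simple_graph G ->
  qform G x = (\sum_(i | i != v) x i * \sum_(j | G i j && (j != v)) x j)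
              + 2 * x v * adj_sum G x v.
Proof.
move=> [Gs Gi]; rewrite /qform (bigD1 v) //=.
under [X in _ + X = _]eq_bigr => i niv do
  rewrite /adj_sum big_mkcond (bigD1 v) //= -big_mkcondl mulrDr.
rewrite big_split /=.
have -> : \sum_(i | i != v) x i * (if G i v then x v else 0)
        = x v * adj_sum G x v.
  rewrite /adj_sum mulr_sumr [RHS]big_mkcond [RHS](bigD1 v) //= Gi add0r.
  by apply: eq_bigr => i _; rewrite Gs; case: (G v i); rewrite ?mulr0 // mulrC.
rewrite addrA [RHS]addrC; congr (_ + _); ring.
Qed.

Lemma sqnorm_split x v : sqnorm x = \sum_(i | i != v) x i ^+ 2 + x v ^+ 2.
Proof. by rewrite /sqnorm (bigD1 v) //= addrC. Qed.

Lemma sqnorm_ge0 x : 0 <= sqnorm x.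
Proof. by apply: sumr_ge0 => i _; apply: sqr_ge0. Qed.

Lemma adj_sum_update G x v t : G v v = false ->
  adj_sum G (update x v t) v = adj_sum G x v.
Proof.
move=> Gvv; apply: eq_bigr => j Gvj; rewrite /update.
by case: eqP => // jv; rewrite jv Gvv in Gvj.
Qed.

Lemma qform_update G H x v t : simple_graph G -> simple_graph H ->
    (forall i j, i != v -> j != v -> H i j = G i j) ->
  qform H (update x v t) =
    qform G x - 2 * x v * adj_sum G x v + 2 * t * adj_sum H x v.
Proof.
move=> sG sH HG; rewrite (qform_split _ v sG) (qform_split _ v sH).
rewrite adj_sum_update; last by case: sH.
have -> : update x v t v = t by rewrite /update eqxx.
rewrite addrK; congr (_ + _).
apply: eq_bigr => i niv; rewrite {1}/update (negPf niv); congr (_ * _).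
apply: eq_big => [j|j /andP[_ /negPf njv]]; last by rewrite /update njv.
by case: (boolP (j == v)) => njv; rewrite ?andbF ?andbT // HG.
Qed.

Lemma sqnorm_update x v t : sqnorm (update x v t) = sqnorm x - x v ^+ 2 + t ^+ 2.
Proof.
have xv : update x v t v = t by rewrite /update eqxx.
rewrite !(sqnorm_split _ v) xv addrK; congr (_ + _).
by apply: eq_bigr => i niv; rewrite /update (negPf niv).
Qed.

Lemma qform_max G : simple_graph G -> (0 < n)%N ->
  exists (l : R) (x : 'I_n -> R),
    [/\ forall i, 0 <= x i, sqnorm x = 1, qform G x = l
      & forall y, qform G y <= l * sqnorm y].
Proof.
move=> sG n0.
have qE (z : 'rV[R]_n) :
    \sum_i \sum_j z 0 i * adj_mx R G i j * z 0 j = qform G (fun i => z 0 i).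
  apply: eq_bigr => i _; rewrite mulr_sumr [RHS]big_mkcond /=.
  apply: eq_bigr => j _; rewrite mxE.
  by case: (G i j); rewrite ?mulr1 // mulr0 mul0r.
have [z [z1 zmax]] := exists_max_on_sphere n0
  (@quadratic_form_continuous R n (adj_mx R G)).
have qmax (y : 'I_n -> R) : sqnorm y = 1 -> qform G y <= qform G (fun i => z 0 i).
  move=> y1; have := zmax (\row_i y i); rewrite !qE.
  have e1 : \sum_i (\row_i y i) 0 i ^+ 2 = 1.
    by rewrite -[RHS]y1; apply: eq_bigr => i _; rewrite mxE.
  move/(_ e1); rewrite /qform /adj_sum.
  by under eq_bigr => i _ do [rewrite mxE; under eq_bigr => j _ do rewrite mxE].
(* Adjacency entries are nonnegative, so taking absolute values keeps the norm and cannot decrease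
   the form. *)
pose x i := `|z 0 i|.
have x1 : sqnorm x = 1.
  by rewrite -z1; apply: eq_bigr => i _; rewrite real_normK ?num_real.
exists (qform G x), x; split => // [i|y]; first exact: normr_ge0.
have [y0|y0] := eqVneq (sqnorm y) 0.
  have yi i : y i = 0.
    apply/eqP; rewrite -sqrf_eq0; apply/eqP.
    by apply: (psumr_eq0P _ y0) => // j _; apply: sqr_ge0.
  rewrite y0 mulr0 /qform big1 // => i _; by rewrite yi mul0r.
have ypos : 0 < sqnorm y by rewrite lt_def y0 sqnorm_ge0.
pose c := Num.sqrt (sqnorm y).
have cpos : 0 < c by rewrite sqrtr_gt0.
have c2 : c ^+ 2 = sqnorm y by rewrite sqr_sqrtr // ltW.
pose w i := y i / c.
have w1 : sqnorm w = 1.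
  rewrite /sqnorm /w; under eq_bigr do rewrite exprMn.
  by rewrite -mulr_suml -/(sqnorm y) -c2 exprVn divff // sqrf_eq0 gt_eqF.
have qw : qform G w = qform G y / c ^+ 2.
  rewrite /qform mulr_suml; apply: eq_bigr => i _.
  by rewrite /adj_sum /w -mulr_suml; field; rewrite gt_eqF.
rewrite -c2 -ler_pdivrMr ?exprn_gt0 // -qw.
apply: le_trans (qmax w w1) _.
rewrite /qform; apply: ler_sum => i _; rewrite /adj_sum !mulr_sumr.
by apply: ler_sum => j _; rewrite /x -normrM ler_norm.
Qed.

Lemma qform_max_eigenvector G l x : simple_graph G ->
    sqnorm x = 1 -> qform G x = l -> (forall y, qform G y <= l * sqnorm y) ->
  forall i, adj_sum G x i = l * x i.
Proof.
move=> sG x1 xl ray v.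
(* Test vector: the indicator of [v], with form 0 and norm 1. *)
have l0 : 0 <= l.
  have := ray (update (fun=> 0) v 1).
  rewrite (@qform_update G G) // sqnorm_update /qform /sqnorm /adj_sum !big1;
    by move=> // *; rewrite ?mul0r ?expr0n //; lra.
(* [g] is the defect in the eigenvalue equation at [v]. Moving [x v] by [t] turns maximality into
   [2 t g <= l t^2], and this choice of [t] makes it [t^2 (l + 2) <= 0]. *)
pose g := adj_sum G x v - l * x v; pose t := g / (l + 1).
have := ray (update x v (x v + t)).
rewrite (@qform_update G G) // sqnorm_update x1 xl.
have -> : adj_sum G x v = g + l * x v by rewrite /g; ring.
have -> : g = t * (l + 1) by rewrite /t; field; lra.
move=> h; suff -> : t = 0 by ring.
have t2 : t ^+ 2 * (l + 2) <= 0 by nra.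
apply/eqP; rewrite -sqrf_eq0; apply/eqP; have := sqr_ge0 t; nra.
Qed.

(** The supremum defining [lambda1] is attained: the maximum of the form on the sphere is an
    eigenvalue, and testing the Rayleigh bound on any eigenvector bounds its eigenvalue. *)
Lemma lambda1_spec G : simple_graph G -> (0 < n)%N ->
  exists x : 'I_n -> R,
    [/\ forall i, 0 <= x i, sqnorm x = 1,
       forall i, adj_sum G x i = lambda1 R G * x i
      & forall y, qform G y <= lambda1 R G * sqnorm y].
Proof.
move=> sG n0; have [l [x [x0 x1 xl ray]]] := qform_max sG n0.
have ev := qform_max_eigenvector sG x1 xl ray.
suff -> : lambda1 R G = l by exists x.
have mulE (u : 'rV[R]_n) i : (u *m adj_mx R G) 0 i = adj_sum G (fun j => u 0 j) i.
  rewrite mxE /adj_sum [RHS]big_mkcond; apply: eq_bigr => j _.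
  by rewrite mxE; case: sG => -> _; case: (G i j); rewrite ?mulr1 ?mulr0.
have lev : eigenvalue (adj_mx R G) l.
  apply/eigenvalueP; exists (\row_i x i).
    apply/rowP => i; rewrite mulE !mxE -ev; apply: eq_bigr => j _.
    by rewrite mxE.
  apply/eqP => /rowP xz; move/eqP: x1; rewrite /sqnorm big1 1?eq_sym ?oner_eq0 //.
  by move=> i _; have := xz i; rewrite !mxE => ->; rewrite expr0n.
have ub mu : eigenvalue (adj_mx R G) mu -> mu <= l.
  move=> /eigenvalueP [u eu u0].
  have q : qform G (fun i => u 0 i) = mu * sqnorm (fun i => u 0 i).
    rewrite /qform /sqnorm mulr_sumr; apply: eq_bigr => i _.
    by rewrite -mulE eu mxE; ring.
  have := ray (fun i => u 0 i); rewrite q ler_pM2r // lt_def sqnorm_ge0 andbT.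
  apply: contra_neq u0 => s0; apply/rowP => i; rewrite mxE; apply/eqP.
  rewrite -sqrf_eq0; apply/eqP; apply: (psumr_eq0P _ s0) => // j _.
  exact: sqr_ge0.
apply/eqP; rewrite eq_le; apply/andP; split.
  by apply: ge_sup; [exists l | move=> mu; apply: ub].
by apply: ub_le_sup => //; exists l => mu; apply: ub.
Qed.

Lemma rayleigh G : simple_graph G -> forall y, qform G y <= lambda1 R G * sqnorm y.
Proof.
case: (posnP n) => [n0|n0] sG; last by have [x []] := lambda1_spec sG n0.
move=> y; rewrite /qform /sqnorm !big1 ?mulr0 // => i;
  by have := ltn_ord i; rewrite {2}n0.
Qed.

Lemma perron G : simple_graph G -> (0 < n)%N ->
  exists x : 'I_n -> R,
    [/\ forall i, 0 <= x i, forall i, x i <= 1, exists u, x u = 1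
      & forall i, adj_sum G x i = lambda1 R G * x i].
Proof.
move=> sG n0; have [x [x0 x1 ev _]] := lambda1_spec sG n0.
pose i0 := Ordinal n0.
have [u umax] : exists u, forall i, x i <= x u.
  by case: (@Order.TotalTheory.arg_maxP _ R 'I_n i0 xpredT x isT) => u _ mu;
    exists u => i; apply: mu.
have upos : 0 < x u.
  rewrite lt_def x0 andbT; apply: contra_eq_neq x1 => u0.
  rewrite /sqnorm big1 1?eq_sym ?oner_eq0 // => i _.
  suff -> : x i = 0 by rewrite expr0n.
  by apply/eqP; rewrite eq_le x0 -u0 umax.
exists (fun i => x i / x u); split => [i|i||i].
- by rewrite divr_ge0.
- by rewrite ler_pdivrMr // mul1r.
- by exists u; rewrite divff // gt_eqF.
- by rewrite /adj_sum -mulr_suml -/(adj_sum G x i) ev mulrA.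
Qed.

(* Resetting the weight of [v] to [sum_S x / lambda] in the eigenvector of [G]
   gives a test vector for the modified graph [H]. *)
Lemma modified_neighborhood_sum_le G H x v : simple_graph G -> simple_graph H ->
    lambda1 R H <= lambda1 R G -> 0 < lambda1 R G ->
    (forall i, 0 <= x i) ->
    (forall i, adj_sum G x i = lambda1 R G * x i) ->
    (forall i j, i != v -> j != v -> H i j = G i j) ->
  adj_sum H x v <= lambda1 R G * x v.
Proof.
move=> sG sH; set l := lambda1 R G => Hl l0 x0 ev HG.
set s := adj_sum H x v; pose t := s / l.
have := le_trans (rayleigh sH (update x v t)) (ler_wpM2r (sqnorm_ge0 _) Hl).
rewrite (qform_update x t sG sH HG) sqnorm_update -/l ev -/s.
have -> : qform G x = l * sqnorm x.
  by rewrite /qform /sqnorm mulr_sumr; apply: eq_bigr => i _; rewrite ev; ring.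
have -> : s = t * l by rewrite /t; field; lra.
(* The Rayleigh bound for [H] reads [- 2 l x_v^2 + 2 l t^2 <= - l x_v^2 + l t^2] once the common
   terms cancel. *)
move=> h; have tx : t ^+ 2 <= x v ^+ 2.
  by rewrite -(ler_pM2l l0); nra.
rewrite mulrC ler_pM2l //; apply: le_trans (ler_norm t) _.
by rewrite -(@ler_pXn2r R 2) ?nnegrE // real_normK ?num_real.
Qed.
End Spectral.

(** * Wheels *)

Local Open Scope nat_scope.

(* Cardinals of sets of type [{set 'I_n}] elaborate to terms that agree only up
   to [reverse_coercion], which [lia] does not see through. *)
Ltac set_lia := unfold reverse_coercion in *; lia.

Section Wheels.
Variables (n k : nat) (G : rel 'I_n).
Hypothesis sG : simple_graph G.
Implicit Types (h v y r : 'I_n) (c ys p rs : seq 'I_n) (ps : seq (seq 'I_n)).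

Definition nbr v : {set 'I_n} := [set w | G v w].

Lemma wheel_of_cycle h c : size c = 2 * k -> uniq (h :: c) -> cycle G c ->
  all (G h) c -> contains (@wheel (2 * k + 1)) G.
Proof.
have [Gs Gi] := sG.
move=> sc uc cc hc; pose f (i : 'I_(2 * k + 1)) := nth h (h :: c) i.
have sz : size (h :: c) = 2 * k + 1 by rewrite /= sc addn1.
exists f; split; [|split=> [x|x y]]; last 2 first.
- by rewrite inE.
(* One orientation of each kind of wheel edge: spoke, consecutive rim vertices, closing rim edge.
   The other orientations follow by symmetry of [G]. *)
- have key (a b : nat) : a < 2 * k + 1 -> b < 2 * k + 1 ->
      (a == 0) && (b != 0) || [&& 0 < a, 0 < b & (b == a.+1)
         || ((a == 1) && (b == (2 * k + 1).-1))] ->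
      G (nth h (h :: c) a) (nth h (h :: c) b)
      \/ G (nth h (h :: c) b) (nth h (h :: c) a).
    move=> la lb; case/orP => [/andP[/eqP -> b0]|/and3P[a0 b0 ab]].
      left; rewrite -(prednK (n := b)) ?lt0n //=.
      by apply: (allP hc); apply: mem_nth; rewrite sc; move: b0 lb; lia.
    case: c cc sc sz {hc uc f} => [|z c'] cc sc sz.
      by exfalso; rewrite /= in sc; lia.
    have /(pathP h) pc := cc.
    case/orP: ab => [/eqP ba|/andP[/eqP a1 /eqP bl]].
      left; rewrite ba -(prednK a0) /=.
      have lt : a.-1 < size c' by have := sz; move: ba a0 => /=; lia.
      have := pc a.-1; rewrite size_rcons => /(_ (ltnW lt)).
      by rewrite -rcons_cons !nth_rcons lt [_ < _](leqW lt).
    right; rewrite a1 bl addn1 /= -sc /=.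
    have := pc (size c'); rewrite size_rcons => /(_ (ltnSn _)).
    by rewrite -rcons_cons !nth_rcons ltnSn ltnn eqxx.
  have wlogG (a b : 'I_(2 * k + 1)) := key a b (ltn_ord a) (ltn_ord b).
  move=> /andP[_ w].
  suff [|//] : G (f x) (f y) \/ G (f y) (f x) by rewrite Gs.
  case/orP: w => [/orP[]|] w.
  + by apply: wlogG; rewrite w.
  + by apply/or_comm/wlogG; rewrite w.
  case/andP: w => /andP[x0 y0] /orP[/orP[/orP[w|w]|/andP[w1 w2]]|/andP[w1 w2]].
  + by apply/or_comm/wlogG; rewrite x0 y0 w /= orbT.
  + by apply: wlogG; rewrite x0 y0 w /= orbT.
  + by apply: wlogG; rewrite x0 y0 w1 w2 /= !orbT.
  + by apply/or_comm/wlogG; rewrite x0 y0 w1 w2 /= !orbT.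
- move=> x y /eqP; rewrite /f nth_uniq ?sz // => /eqP xy; exact: val_inj.
Qed.

Fixpoint weave ys ps : seq 'I_n :=
  match ys, ps with
  | y :: ys', p :: ps' => y :: p ++ weave ys' ps'
  | _, _ => [::]
  end.

Lemma perm_weave ys ps : size ys = size ps ->
  perm_eq (weave ys ps) (ys ++ flatten ps).
Proof.
elim: ys ps => [|y ys IH] [|p ps] //= [/IH {}IH].
rewrite perm_cons perm_sym perm_catCA perm_cat2l perm_sym.
exact: IH.
Qed.

(** Here [x] is the end of the preceding segment. The path must again end in a segment, so that its
    last vertex sees every separator: this carries the induction and later closes the cycle. *)
Lemma weave_path_last ys ps x : size ys = size ps ->
    all (sorted G) ps -> all (fun p => p != [::]) ps ->
    {in ys & flatten ps, forall y r, G y r} -> {in ys, forall y, G x y} ->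
  path G x (weave ys ps) /\ last x (weave ys ps) \in x :: flatten ps.
Proof.
have [Gs Gi] := sG.
elim: ys ps x => [|y ys IH] [|[|r p] ps] x //=; first by rewrite mem_head.
move=> [sz] /andP[sp sps] pn yr xy.
have lp : last r p \in r :: p by rewrite mem_last.
have [|y' y'y|pw lw] := IH ps (last r p) sz sps pn.
- move=> a b ay bp; apply: yr; first by rewrite inE ay orbT.
  by rewrite !inE mem_cat bp !orbT.
- rewrite Gs; apply: yr; first by rewrite inE y'y orbT.
  by rewrite -cat_cons mem_cat lp.
have Gyr : G y r by apply: yr; rewrite mem_head.
rewrite cat_path last_cat /= xy ?mem_head // Gyr sp pw.
split=> //; move: lw; rewrite !inE mem_cat => /orP[/eqP ->|->].
  by move: lp; rewrite inE => /orP[->|->]; rewrite ?orbT.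
by rewrite !orbT.
Qed.

(* The rim is [y_1 p_1 y_2 p_2 ... y_j p_j], the hub is [h]. *)
Lemma wheel_of_segments h ys ps : size ys = size ps ->
    all (sorted G) ps -> all (fun p => p != [::]) ps ->
    0 < size ys -> size ys + size (flatten ps) = 2 * k ->
    uniq ys -> uniq (flatten ps) ->
    {in ys, forall y, G h y} -> {in flatten ps, forall r, G h r} ->
    {in ys & flatten ps, forall y r, G y r} ->
  contains (@wheel (2 * k + 1)) G.
Proof.
have [Gs Gi] := sG => sz sps nps ys0 szk uys ups hys hps yps.
have pw := perm_weave sz.
have hw : all (G h) (weave ys ps).
  apply/allP => r; rewrite (perm_mem pw) mem_cat => /orP[/hys|/hps] //.
apply: (@wheel_of_cycle h (weave ys ps)) => //.
- by rewrite (perm_size pw) size_cat szk.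
- rewrite cons_uniq; apply/andP; split.
    by apply/negP => /(allP hw); rewrite Gi.
  rewrite (perm_uniq pw) cat_uniq uys ups andbT; apply/hasPn => r rp.
  by apply/negP => ry; have := yps _ _ ry rp; rewrite Gi.
case: ys ps sz sps nps ys0 yps {szk uys ups hys hps pw hw} => [|y ys] [|[|r p] ps] //=.
move=> [sz] /andP[sp sps] nps _ yps; rewrite rcons_cat cat_path.
have lp : last r p \in r :: p by rewrite mem_last.
have [|y' y'y|pw lw] := weave_path_last (x := last r p) sz sps nps.
- move=> a b ay bp; apply: yps; first by rewrite inE ay orbT.
  by rewrite !inE mem_cat bp !orbT.
- rewrite Gs; apply: yps; first by rewrite inE y'y orbT.
  by rewrite -cat_cons mem_cat lp.
rewrite sp rcons_path pw /= yps ?mem_head //= Gs; apply: yps; first exact: mem_head.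
move: lw; rewrite !inE mem_cat => /orP[/eqP ->|->]; last by rewrite !orbT.
by move: lp; rewrite inE => /orP[->|->]; rewrite ?orbT.
Qed.

(** Discard from [Z] the at most [m] non-neighbours of each [y] and the forbidden [F]; at least [j]
    vertices survive. *)
Lemma common_neighbors (Z : {set 'I_n}) (Y F : seq 'I_n) m j :
    {in Y, forall y, #|Z :\: nbr y| <= m} -> size Y * m + size F + j <= #|Z| ->
  exists rs, [/\ size rs = j, uniq rs, {subset rs <= Z},
    {in rs, forall r, r \notin F} & {in Y & rs, forall y r, G y r}].
Proof.
move=> Ym sz.
pose B := \bigcup_(y <- Y) (Z :\: nbr y).
have cB : #|B| <= size Y * m.
  rewrite /B; elim: Y Ym {sz B} => [|y Y IH] Ym; first by rewrite big_nil cards0.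
  rewrite big_cons mulSn; apply: leq_trans (leq_card_setU _ _) _.
  apply: leq_add; first by apply: Ym; rewrite mem_head.
  by apply: IH => z zY; apply: Ym; rewrite inE zY orbT.
pose D := (Z :\: B) :\: [set z in F].
have cD : j <= #|D|.
  have c1 := cardsID B Z; have c2 := cardsID [set z in F] (Z :\: B).
  have c3 : #|Z :&: B| <= #|B| by rewrite subset_leq_card ?subsetIr.
  have c4 : #|(Z :\: B) :&: [set z in F]| <= size F.
    apply: leq_trans (card_size F); rewrite -[X in _ <= X]cardsE.
    by rewrite subset_leq_card ?subsetIr.
  rewrite /D; set_lia.
exists (take j (enum D)); split.
- by rewrite size_take -cardE; case: ltngtP cD.
- by rewrite take_uniq // enum_uniq.
- by move=> r /mem_take; rewrite mem_enum !inE => /andP[_ /andP[_ ->]].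
- by move=> r /mem_take; rewrite mem_enum !inE => /andP[-> _].
move=> y r yY /mem_take; rewrite mem_enum !inE => /andP[_ /andP[rB rZ]].
apply: contraR rB => Gyr; rewrite /B (big_rem y) //= inE; apply/orP; left.
by rewrite !inE Gyr rZ.
Qed.

(** A [K_{k,k}] inside the neighbourhood of [h] contains a rim [C_{2k}]: take single vertices as
    segments. *)
Lemma no_common_biclique h ys rs : Defs.free (@wheel (2 * k + 1)) G -> 0 < k ->
    size ys = k -> size rs = k -> uniq ys -> uniq rs ->
    {in ys, forall y, G h y} -> {in rs, forall r, G h r} ->
    {in ys & rs, forall y r, G y r} -> False.
Proof.
move=> fG k0 sy sr uy ur hy hr yr; apply: fG.
have fl : flatten [seq [:: r] | r <- rs] = rs.
  by rewrite -[RHS]map_id; elim: (rs) => //= a l ->.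
apply: (@wheel_of_segments h ys [seq [:: r] | r <- rs]); rewrite ?fl //.
- by rewrite size_map sy sr.
- by apply/allP => p /mapP[r _ ->].
- by apply/allP => p /mapP[r _ ->].
- by rewrite sy.
- by rewrite sy sr; lia.
Qed.
End Wheels.

(** * Rewiring a single vertex *)

Definition reset_nbr n (G : rel 'I_n) (v : 'I_n) (S : {set 'I_n}) : rel 'I_n :=
  fun a b => if a == v then (b != v) && (b \in S)
             else if b == v then a \in S else G a b.

Lemma reset_nbr_simple n (G : rel 'I_n) v S :
  simple_graph G -> simple_graph (reset_nbr G v S).
Proof.
move=> [Gs Gi]; split=> [a b|a]; rewrite /reset_nbr.
  by case: (eqVneq a v) => av; case: (eqVneq b v) => bv //=.
by case: (eqVneq a v) => av //=.
Qed.

(* A wheel through [v] is moved off [v] by substituting a vertex [b] of [G]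
   adjacent to all the new neighbours of [v] that the wheel uses. *)
Lemma reset_nbr_free n k (G : rel 'I_n) v (S : {set 'I_n}) : simple_graph G ->
    Defs.free (@wheel (2 * k + 1)) G ->
    (forall F : seq 'I_n, size F = 2 * k + 1 ->
       exists b, b \notin F /\ {in F, forall t, t \in S -> G b t}) ->
  Defs.free (@wheel (2 * k + 1)) (reset_nbr G v S).
Proof.
move=> [Gs Gi] fG rep [f [finj [_ fE]]]; apply: fG.
have Gsym x y : reset_nbr G v S x y = reset_nbr G v S y x.
  by have [+ _] := reset_nbr_simple v S (conj Gs Gi); apply.
have [[i0 i0v]|nov] := boolp.pselect (exists i, f i = v); last first.
  exists f; split => //; split=> [x|x y /fE]; first by rewrite inE.
  rewrite /reset_nbr.
  by case: eqP => [fx|_]; [case: nov; exists x | case: eqP => [fy|//]; case: nov; exists y].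
have [b [bF bS]] := rep (codom f) (etrans (size_codom _) (card_ord _)).
exists (fun i => if i == i0 then b else f i); split; [|split=> [x|x y Wxy]].
- move=> x y; case: eqP => [->|xi]; case: eqP => [->|yi] //.
  + by move=> bf; case/negP: bF; rewrite bf codom_f.
  + by move=> bf; case/negP: bF; rewrite -bf codom_f.
  exact: finj.
- by rewrite inE.
have neq z : z <> i0 -> f z == v = false.
  by move=> zi; apply/eqP; rewrite -i0v => /finj.
have := fE _ _ Wxy; case: eqP => [->|xi]; case: eqP => [->|yi].
- by rewrite i0v /reset_nbr !eqxx.
- rewrite i0v /reset_nbr eqxx => /andP[_ yS]; apply: bS => //.
  exact: codom_f.
- rewrite Gsym i0v /reset_nbr eqxx Gs => /andP[_ xS]; apply: bS => //.
  exact: codom_f.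
- by rewrite /reset_nbr !neq.
Qed.

(** * A wheel-free graph with large spectral radius *)

(** The rim is indexed periodically by all naturals, so the cyclic successor is simply [.+1] and a
    walk may start anywhere. *)
Lemma rim_of_wheel k n (G : rel 'I_n) : 1 < k -> contains (@wheel (2 * k + 1)) G ->
  exists h (g : nat -> 'I_n),
    [/\ forall i, G h (g i), forall i, G (g i) (g i.+1)
      & forall i j, g i = g j <-> i = j %[mod 2 * k]].
Proof.
move=> k1 [f [finj [_ fE]]].
have lt i : (i %% (2 * k)).+1 < 2 * k + 1.
  by rewrite addn1 ltnS ltn_mod; lia.
pose o i := Ordinal (lt i); have lt0 : 0 < 2 * k + 1 by rewrite addn1.
exists (f (Ordinal lt0)), (fun i => f (o i)); split=> [i|i|i j]; last 1 first.
    by split=> [/finj [] //|ij]; congr f; apply: val_inj; rewrite /= ij.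
  by apply: fE; rewrite /wheel -val_eqE.
apply: fE; rewrite /wheel -val_eqE /= addn1 !eqSS /=.
have k2 : 1 < 2 * k by lia.
have := ltn_pmod i (ltnW k2).
have -> : i.+1 %% (2 * k) = (i %% (2 * k) + 1) %% (2 * k) by rewrite modnDml addn1.
set a := i %% _ => la.
have [ea|ea] := eqVneq a.+1 (2 * k).
  by rewrite addn1 ea modnn eqxx /= !orbT andbT -lt0n; move: ea k2; lia.
have -> : (a + 1) %% (2 * k) = a.+1 by rewrite addn1 modn_small //; lia.
by rewrite eqxx /= !orbT andbT; lia.
Qed.

(** * Regular graphs with small components *)

Lemma sum_nat_range0 m p (F : nat -> nat) :
  (forall j, m <= j < p -> F j = 0) -> \sum_(m <= j < p) F j = 0.
Proof. by move=> F0; rewrite big_nat big1. Qed.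

Lemma sum_nat_shift m b (F : nat -> nat) :
  \sum_(m <= j < m + b) F j = \sum_(0 <= j < b) F (j + m).
Proof. by rewrite -{1}[m]add0n big_addn addKn. Qed.

(* [c] labels connected components (possibly merging some). *)
Definition regular_small (d s m : nat) (e : rel nat) (c : nat -> nat) : Prop :=
  [/\ symmetric e, irreflexive e, forall i j, e i j -> c i = c j,
      forall i, i < m -> \sum_(0 <= j < m) (e i j : nat) = d
    & forall i, i < m -> \sum_(0 <= j < m) ((c j == c i) : nat) <= s].

Lemma regular_small_add d s m b e c e0 c0 :
  regular_small d s m e c -> regular_small d s b e0 c0 ->
  exists e' c', regular_small d s (m + b) e' c'.
Proof.
move=> [es ei ec ed cs] [e0s e0i e0c e0d c0s].
exists (fun i j => if i < m then (j < m) && e i j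
                   else (m <= j) && e0 (i - m) (j - m)).
(* Even labels for the first graph and odd ones for the second, so labels from different parts never
   collide. *)
exists (fun i => if i < m then (c i).*2 else (c0 (i - m)).*2.+1).
split.
- move=> i j; rewrite es e0s (leqNgt m i) (leqNgt m j).
  by case: (i < m); case: (j < m).
- by move=> i; rewrite ei e0i !andbF if_same.
- move=> i j; case: (ltnP i m) => im.
    by case/andP => -> /ec ->.
  by rewrite ltnNge; case/andP => -> /e0c ->.
- move=> i ib; rewrite (big_cat_nat (n:=m)) ?leq_addr //=.
  case: (ltnP i m) => im.
    rewrite [X in _ + X]sum_nat_range0 ?addn0 => [|j /andP[mj _]].
      rewrite -[RHS](ed i im) big_nat [RHS]big_nat.
      by apply: eq_bigr => j /andP[_ ->].
    by rewrite ltnNge mj.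
  rewrite sum_nat_range0 ?add0n => [|j /andP[_ jm]]; last first.
    by rewrite leqNgt jm.
  rewrite sum_nat_shift.
  rewrite -(e0d (i - m)); last by move: ib im; lia.
  by apply: eq_bigr => j _; rewrite leq_addl addnK.
- move=> i ib; rewrite (big_cat_nat (n:=m)) ?leq_addr //=.
  case: (ltnP i m) => im.
    rewrite [X in _ + X]sum_nat_range0 ?addn0 => [|j /andP[mj _]].
      apply: leq_trans (cs i im); rewrite big_nat [X in _ <= X]big_nat.
      by apply: leq_sum => j /andP[_ ->]; rewrite -!muln2 eqn_pmul2r.
    by rewrite ltnNge mj /=; case: eqP => //; lia.
  rewrite sum_nat_range0 ?add0n => [|j /andP[_ jm]]; last first.
    by rewrite jm; case: eqP => //; lia.
  rewrite sum_nat_shift.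
  have lt : i - m < b by move: ib im; lia.
  apply: leq_trans (c0s (i - m) lt); apply: leq_sum => j _.
  by rewrite ltnNge leq_addl /= addnK eqSS -!muln2 eqn_pmul2r.
Qed.

Lemma regular_small_complete d s : d < s ->
  regular_small d s d.+1 (fun i j => i != j) (fun=> 0).
Proof.
move=> ds; split=> [i j|i|//|i id|i _]; rewrite ?eqxx //.
- by rewrite eq_sym.
- rewrite big_mkord (bigD1 (Ordinal id)) //= eqxx add0n.
  under eq_bigr => j nj.
    have -> : (i != j) = true by move: nj; rewrite -val_eqE eq_sym.
    over.
  by rewrite sum1_card cardC1 card_ord.
- by rewrite big_mkord /= sum1_card card_ord.
Qed.

Lemma regular_small_bipartite d s : 2 * d <= s ->
  regular_small d s (2 * d) (fun i j => (i < d) != (j < d)) (fun=> 0).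
Proof.
move=> ds; split=> [i j|i|//|i id|i _]; rewrite ?eqxx //.
- by rewrite eq_sym.
- rewrite (big_cat_nat (n:=d)) //=; last by lia.
  rewrite mul2n -addnn sum_nat_shift.
  rewrite big_nat_cond [X in _ + X]big_nat_cond.
  under eq_bigr => j /andP[/andP[_ jd] _] do rewrite jd.
  under [X in _ + X]eq_bigr => j _ do rewrite [_ + d < d]ltnNge leq_addl /=.
  rewrite -!big_nat_cond !big_mkord !sum_nat_const !card_ord.
  by case: (i < d); rewrite /= ?muln1 ?muln0 ?addn0.
- by rewrite big_mkord /= sum1_card card_ord.
Qed.

(** Disjoint union of [p] copies of [K_{d+1}] and [r] copies of [K_{d,d}]. *)
Lemma regular_small_blocks d p r : 0 < d -> exists e c,
  regular_small d (2 * d) (p * d.+1 + r * (2 * d)) e c.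
Proof.
move=> d0; elim: p => [|p [e [c IH]]].
  elim: r => [|r [e [c IH]]].
    by exists (fun _ _ => false), (fun=> 0); split.
  rewrite mul0n add0n in IH; rewrite mul0n add0n [r.+1 * _]mulSn addnC.
  exact: (regular_small_add IH (regular_small_bipartite (leqnn (2 * d)))).
rewrite [p.+1 * _]mulSn -addnA addnC.
by apply: (regular_small_add IH); apply: regular_small_complete; lia.
Qed.

(** * The comparison graph *)

Section Target.
Variables (n l d : nat) (e : rel nat) (c : nat -> nat).
Hypotheses (d1 : 0 < d) (ln : l + 1 < n) (H : regular_small d (2 * d) l e c).

(** The extremal shape: [e] on the first [l] vertices, a complete join to the rest, and the single
    edge between [l] and [l.+1] on the right. *)
Definition target : rel 'I_n := fun i j =>
  if i < l then (if j < l then e i j else true)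
  else if j < l then true
  else ((i == l :> nat) && (j == l.+1 :> nat))
    || ((i == l.+1 :> nat) && (j == l :> nat)).

Lemma target_simple : simple_graph target.
Proof using H.
have [es ei _ _ _] := H; split=> [i j|i]; rewrite /target.
  case: (i < l); case: (j < l); rewrite //.
  by rewrite orbC; congr (_ || _); rewrite andbC.
by case: ltnP; rewrite ?ei //; case: eqP => [->|_]; rewrite ?andbF ?(ltn_eqF (ltnSn l)).
Qed.

Lemma card_nbr_target (h : 'I_n) : h < l -> #|[set z | target h z && (z < l)]| = d.
Proof.
have [_ _ _ ed _] := H.
move=> hl; rewrite -[RHS](ed h hl) big_mkord.
rewrite (big_ord_widen n (fun j => (e h j : nat))); last by move: ln; clear; lia.
rewrite -sum1_card big_mkcond [RHS]big_mkcond; apply: eq_bigr => z _.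
by rewrite inE /target hl; case: (z < l); rewrite /= ?andbT ?andbF //; case: (e h z).
Qed.

(** With the hub on the left, at most [d] of the [2d + 2] rim vertices are on the left, which forces
    two rim edges inside the right side. With the hub on the right, at most one rim vertex is on the
    right, and the others form a path of [2d + 1] vertices in one component on the left, which is
    too many. *)
Lemma target_free : Defs.free (@wheel (2 * d.+1 + 1)) target.
Proof.
have [es ei ec ed cs] := H.
move=> /(@rim_of_wheel d.+1 n target) [//|h [g [hg gg ginj]]].
have ginj' (i j : 'I_(2 * d.+1)) : g i = g j -> i = j.
  by move/ginj; rewrite !modn_small // => /val_inj.
case: (ltnP h l) => hl.
  pose A := [set i : 'I_(2 * d.+1) | g i < l].
  have cA : #|A| <= d.
    rewrite -(card_in_imset (f := fun i : 'I__ => g i)); last by move=> i j _ _ /ginj'.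
    apply: leq_trans (eq_leq (card_nbr_target hl)).
    apply: subset_leq_card; apply/subsetP => z /imsetP[i]; rewrite !inE => gl ->.
    by rewrite hg.
  (* Rim edges inside the right side. Two of them would be the same edge, traversed in the same
     direction (equal indices) or in opposite directions (impossible on a rim of length at least
     4). *)
  pose B := [set i : 'I_(2 * d.+1) | (l <= g i) && (l <= g i.+1)].
  have cB : #|B| <= 1.
    rewrite leqNgt; apply/negP => /card_gt1P [i [j [iB jB /eqP ij]]]; apply: ij.
    move: iB jB; rewrite !inE => /andP[i1 i2] /andP[j1 j2].
    have neq (a b : nat) : g a = g b.+1 -> g a.+1 = g b -> False.
      move=> /ginj e1 /ginj /eqP; rewrite -addn1 -modnDml e1 modnDml.
      rewrite -addn1 -addnA -{2}[b]addn0 eqn_modDl mod0n modn_small //; lia.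
    move: (gg i) (gg j); rewrite /target !ltnNge i1 i2 j1 j2 /=.
    by move=> /orP[] /andP[/eqP gi /eqP gi1] /orP[] /andP[/eqP gj /eqP gj1];
      try (by apply: ginj'; apply: val_inj; rewrite /= gi gj);
      case: (neq i j); apply: val_inj; rewrite /= ?gi ?gi1 ?gj ?gj1.
  have shift : \sum_(i < 2 * d.+1) (l <= g i.+1 : nat) = \sum_(i < 2 * d.+1) (l <= g i : nat).
    rewrite -!(big_mkord xpredT (fun i => (l <= g i : nat))).
    rewrite -(big_mkord xpredT (fun i => (l <= g i.+1 : nat))).
    have -> : 2 * d.+1 = (2 * d).+2 by lia.
    have gp : g (2 * d).+2 = g 0.
      by apply/ginj; rewrite mod0n (_ : (2 * d).+2 = 2 * d.+1) ?modnn //; lia.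
    by rewrite big_nat_recr //= [RHS]big_nat_recl //= addnC gp.
  have lA : \sum_(i < 2 * d.+1) (l <= g i : nat) + #|A| = 2 * d.+1.
    rewrite -sum1_card [X in _ + X]big_mkcond -big_split /= -[RHS]card_ord -sum1_card.
    by apply: eq_bigr => i _; rewrite inE ltnNge; case: (l <= g i).
  (* Count right ends of rim edges: each edge has at most one, plus one more for the edges in [B].
     By [shift] the left side is twice the number of right rim vertices. *)
  have : \sum_(i < 2 * d.+1) ((l <= g i : nat) + (l <= g i.+1 : nat))
      <= \sum_(i < 2 * d.+1) (1 + (if i \in B then 1 else 0)).
    by apply: leq_sum => i _; rewrite inE; case: (l <= g i); case: (l <= g i.+1).
  rewrite !big_split /= shift sum_nat_const card_ord muln1.
  have -> : \sum_(i < 2 * d.+1) (if i \in B then 1 else 0) = #|B|.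
    by rewrite -big_mkcond sum1_card.
  move: cA cB lA; move: #|A| #|B| (\sum_(i < _) _) => a b S; lia.
(* Start at the rim vertex on the right if there is one, and anywhere otherwise. *)
have [i0 i0P] : exists i0, forall j, 0 < j < 2 * d.+1 -> g (i0 + j) < l.
  have [[i0 i0l]|no] := boolp.pselect (exists i0, l <= g i0); last first.
    exists 0 => j _; rewrite ltnNge; apply/negP => jl; apply: no; by exists (0 + j).
  exists i0 => j /andP[j0 jd]; rewrite ltnNge; apply/negP => jl.
  have : g i0 = g (i0 + j).
    apply: val_inj; move: (hg i0) (hg (i0 + j)).
    rewrite /target !ltnNge hl i0l jl /=.
    by move=> /orP[] /andP[/eqP a1 /eqP a2] /orP[] /andP[/eqP a3 /eqP a4]; lia.
  move/ginj/eqP; rewrite -{1}[i0]addn0 eqn_modDl mod0n modn_small //; lia.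
pose f (j : 'I_(2 * d).+1) := g (i0 + j.+1).
have fl j : f j < l by apply: i0P; have := ltn_ord j; lia.
have fc j : j < (2 * d).+1 -> c (g (i0 + j.+1)) = c (g (i0 + 1)).
  elim: j => [//|j IH] jd; rewrite -IH; last exact: ltnW.
  apply/esym/ec; have := gg (i0 + j.+1); rewrite -addnS /target.
  by rewrite !i0P //; lia.
have finj : injective f.
  move=> i j /ginj /eqP; rewrite eqn_modDl => /eqP.
  rewrite !modn_small => [[ij]||]; first exact: val_inj.
    by have := ltn_ord j; lia.
  by have := ltn_ord i; lia.
have := cs (f ord0) (fl ord0); rewrite leqNgt => /negP; apply.
rewrite big_mkord (big_ord_widen n (fun j => (c j == c (f ord0) : nat)));
  last by move: ln; lia.
rewrite -{1}(card_ord (2 * d).+1) -(card_imset _ finj) -sum1_card.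
rewrite big_mkcond [X in _ <= X]big_mkcond; apply: leq_sum => z _.
case: imsetP => // [[j _ ->]].
by rewrite fl /f !fc ?eqxx.
Qed.
End Target.

Local Open Scope ring_scope.

Lemma card_ord_lt (n l : nat) : (l <= n)%N -> #|[set j : 'I_n | (j < l)%N]| = l.
Proof.
move=> ln; rewrite -sum1_card; under eq_bigl => j do rewrite inE.
by rewrite -(big_ord_widen n (fun=> 1%N)) ?sum1_card ?card_ord.
Qed.

(** The three terms come from the left edges, the join and the single right edge. On the right only
    the contribution of that edge is kept and the other weights are dropped, which uses [0 <= b]. *)
Lemma qform_target (R : realType) (n l d : nat) e c (a b : R) :
    (l + 1 < n)%N -> regular_small d (2 * d) l e c -> 0 <= b ->
  a ^+ 2 * d%:R * l%:R + 2 * a * b * l%:R * (n - l)%:R + 2 * b ^+ 2 <=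
  qform (target (n := n) l e) (fun i => if (i < l)%N then a else b).
Proof.
move=> ln H b0; pose y (i : 'I_n) := if (i < l)%N then a else b.
have cL : #|[set j : 'I_n | (j < l)%N]| = l. by apply: card_ord_lt; lia.
have cR : #|[set j : 'I_n | (l <= j)%N]| = (n - l)%N.
  have -> : [set j : 'I_n | (l <= j)%N] = ~: [set j : 'I_n | (j < l)%N].
    by apply/setP => j; rewrite !inE leqNgt.
  by have := cardsC [set j : 'I_n | (j < l)%N]; rewrite cL card_ord; lia.
have adjL (i : 'I_n) : (i < l)%N ->
    adj_sum (target (n := n) l e) y i = d%:R * a + (n - l)%:R * b.
  move=> il; rewrite /adj_sum (bigID (fun j : 'I_n => (j < l)%N)) /=.
  rewrite -[X in X%:R * a](card_nbr_target ln H il) -cR.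
  rewrite !mulr_natl -!sumr_const; congr (_ + _).
    by apply: eq_big => [j|j /andP[_ jl]]; rewrite ?inE // /y jl.
  apply: eq_big => [j|j /andP[_ /negPf jl]]; last by rewrite /y jl.
  by rewrite inE /target il; case: ltnP; rewrite ?andbF.
have ll : (l + 1 < l)%N = false by rewrite ltnNge leq_addr.
pose o1 := Ordinal (leq_ltn_trans (leq_addr 1 l) ln).
pose o2 := Ordinal ln.
have adjR (i : 'I_n) : (l <= i)%N ->
    l%:R * a + b * ((i == o1) || (i == o2))%:R <= adj_sum (target (n := n) l e) y i.
  move=> il; have nl : (i < l)%N = false by rewrite ltnNge il.
  rewrite /adj_sum (bigID (fun j : 'I_n => (j < l)%N)) /=.
  rewrite -{1}cL mulr_natl -sumr_const; apply: lerD.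
    rewrite le_eqVlt; apply/orP; left; apply/eqP.
    apply: eq_big => [j|j]; last by rewrite inE /y => ->.
    by rewrite inE /target nl; case: (j < l)%N; rewrite ?andbF.
  have y0 (j : 'I_n) : true && ~~ (j < l)%N -> 0 <= y j.
    by rewrite /y => /negPf ->.
  have sum0 (P : pred 'I_n) : 0 <= \sum_(j | P j && ~~ (j < l)%N) y j.
    by apply: sumr_ge0 => j /andP[_ jl]; apply: y0.
  have [ei|_] := eqVneq i o1.
    rewrite mulr1 (bigD1 o2) /=; last by rewrite ei /target /= ll ltnn addn1 !eqxx ?orbT.
    rewrite {1}/y /= ll lerDl.
    by apply: sumr_ge0 => j /andP[/andP[_ jl] _]; apply: y0.
  have [ei|_] := eqVneq i o2; last by rewrite mulr0.
  rewrite mulr1 (bigD1 o1) /=; last by rewrite ei /target /= ll ltnn addn1 !eqxx ?orbT.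
  rewrite {1}/y /= ltnn lerDl.
  by apply: sumr_ge0 => j /andP[/andP[_ jl] _]; apply: y0.
rewrite -/y /qform (bigID (fun j : 'I_n => (j < l)%N)) /=.
have -> : \sum_(i < n | (i < l)%N) y i * adj_sum (target (n := n) l e) y i
   = l%:R * (a * (d%:R * a + (n - l)%:R * b)).
  rewrite -[X in _ = X%:R * _]cL mulr_natl -sumr_const.
  by apply: eq_big => [j|j jl]; rewrite ?inE // adjL // /y jl.
have : \sum_(i < n | ~~ (i < l)%N) b * (l%:R * a + b * ((i == o1) || (i == o2))%:R)
   <= \sum_(i < n | ~~ (i < l)%N) y i * adj_sum (target (n := n) l e) y i.
  by apply: ler_sum => i il; rewrite /y (negPf il) ler_wpM2l // adjR // leqNgt.
have -> : \sum_(i < n | ~~ (i < l)%N) b * (l%:R * a + b * ((i == o1) || (i == o2))%:R)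
   = (n - l)%:R * (b * (l%:R * a)) + 2 * b ^+ 2.
  under eq_bigr => i _ do rewrite mulrDr.
  rewrite big_split /=; congr (_ + _).
    rewrite -[X in _ = X%:R * _]cR -sumr_const mulr_suml.
    by apply: eq_big => [j|j _]; [rewrite inE -leqNgt | rewrite mul1r].
  rewrite (bigD1 o1) /=; last by rewrite ltnn.
  rewrite (bigD1 o2) /=; last by rewrite -val_eqE /= -leqNgt leq_addr /=; lia.
  rewrite !eqxx /= orbT big1 ?addr0; first by rewrite !mulr1; ring.
  by move=> j /andP[/andP[_ /negPf ->] /negPf ->]; rewrite !mulr0.
by nra.
Qed.

Definition near_half (n l : nat) := l = n./2 \/ l = n./2.+1.

(** The block sizes are 4 and 6 for [k = 4], which reach every large even [l], and 5 and 8 for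
    [k = 5], which reach every large [l]. Parity is why [near_half] allows two values. *)
Lemma target_exists k n : (k = 4 \/ k = 5)%N -> (100 <= n)%N ->
  exists l e c, near_half n l /\ regular_small k.-1 (2 * k.-1) l e c.
Proof.
move=> hk n100.
suff [l [p [r [lh lE]]]] : exists l p r, near_half n l /\
    l = (p * k.-1.+1 + r * (2 * k.-1))%N.
  have k0 : (0 < k.-1)%N by case: hk => ->.
  have [e [c H]] := regular_small_blocks p r k0.
  by exists l, e, c; rewrite lE in lh *.
rewrite /near_half; case: hk => -> /=; last first.
  (* Since [8 * 2 = 1] modulo 5, the number [r = 2 l mod 5] satisfies [8 r = l] modulo 5. *)
  exists n./2, ((n./2 - 8 * ((2 * n./2) %% 5)) %/ 5)%N, ((2 * n./2) %% 5)%N.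
  by split; [left | lia].
pose l := (n./2 + odd n./2)%N.
(* One block of size 6 is used exactly when the even number [l] is 2 modulo 4. *)
exists l, ((l - 6 * (l %% 4 %/ 2)) %/ 4)%N, (l %% 4 %/ 2)%N.
have le : ~~ odd l by rewrite /l oddD oddb addbb.
split; first by rewrite /l; case: odd; [right | left]; rewrite ?addn0 ?addn1.
have : (100 <= l * 2 + 1)%N by rewrite /l; lia.
by move: l le => l; lia.
Qed.

Lemma lambda1_lower_bound (R : realType) (k n : nat) (G : rel 'I_n) :
    (k = 4 \/ k = 5)%N -> (100 <= n)%N -> SPEX R (@wheel (2 * k + 1)) G ->
  let lam := lambda1 R G in
  0 < lam /\ exists l, near_half n l /\
    2 * l%:R <= lam * (lam ^+ 2 - k.-1%:R * lam - l%:R * (n - l)%:R).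
Proof.
move=> hk n100 [sG [fG maxG]] lam.
have k0 : (0 < k.-1)%N by case: hk => ->.
have [l [e [c [lh H]]]] := target_exists hk n100.
have ln : (l + 1 < n)%N by case: lh => ->; lia.
have l0 : (0 < l)%N by case: lh => ->; lia.
have sT := target_simple n H.
have fT := target_free k0 ln H; rewrite prednK in fT; last by case: hk => ->.
have lT := maxG _ sT fT; rewrite -/lam in lT.
have ray a b : 0 <= b -> a ^+ 2 * k.-1%:R * l%:R + 2 * a * b * l%:R * (n - l)%:R + 2 * b ^+ 2
    <= lam * (l%:R * a ^+ 2 + (n - l)%:R * b ^+ 2).
  move=> b0; apply: le_trans (qform_target a ln H b0) _.
  apply: (le_trans (rayleigh sT _)).
  have -> : l%:R * a ^+ 2 + (n - l)%:R * b ^+ 2 =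
      sqnorm (fun i : 'I_n => if (i < l)%N then a else b).
    have ll : (l <= n)%N by lia.
    have cR : #|~: [set i : 'I_n | (i < l)%N]| = (n - l)%N.
      have := cardsC [set i : 'I_n | (i < l)%N].
      by rewrite card_ord_lt ?card_ord; lia.
    rewrite /sqnorm (bigID (fun i : 'I_n => (i < l)%N)) /=; congr (_ + _).
      rewrite -{1}(card_ord_lt ll) mulr_natl -sumr_const.
      by apply: eq_big => [i|i]; rewrite inE // => ->.
    rewrite -{1}cR mulr_natl -sumr_const; apply: eq_big => [i|i]; rewrite !inE //.
    by move/negPf => ->.
  by apply: ler_wpM2r lT; apply: sqnorm_ge0.
have lR : 0 < l%:R :> R by rewrite ltr0n.
have rR : 0 < (n - l)%:R :> R by rewrite ltr0n; lia.
have dR : 0 < k.-1%:R :> R by rewrite ltr0n.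
have lam0 : 0 < lam.
  have := ray 1 1 ler01; rewrite !expr1n !mulr1 => h.
  have p1 := mulr_gt0 lR rR; have p2 := mulr_gt0 dR lR; nra.
split=> //; exists l; split=> //.
(* With [a = lam] and [b = l] the equation [lam b = l a] holds on the right, apart from the extra
   edge. That edge contributes [2 l^2], and dividing by [l] leaves the gain [2 l]. *)
have := ray lam l%:R (ltW lR) => h.
rewrite -(ler_pM2l lR); nra.
Qed.

(** * Bicliques in dense graphs *)

Local Open Scope nat_scope.

Lemma exists_subseq_card (T : finType) (A : {set T}) m : m <= #|A| ->
  exists s : seq T, [/\ size s = m, uniq s & {subset s <= A}].
Proof.
move=> mA; exists (take m (enum A)); split.
- by rewrite size_take -cardE; case: ltngtP mA.
- by rewrite take_uniq // enum_uniq.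
- by move=> x /mem_take; rewrite mem_enum.
Qed.

Lemma exists_subset_card (T : finType) (A : {set T}) m : m <= #|A| ->
  exists S : {set T}, S \subset A /\ #|S| = m.
Proof.
move=> /exists_subseq_card [s [ss us sA]]; exists [set x in s]; split.
  by apply/subsetP => x; rewrite inE => /sA.
by rewrite cardsE (card_uniqP us).
Qed.

Section Kovari_Sos_Turan.
Variables (T : finType) (e : rel T).

Definition biclique (A : {set T}) m := exists ys zs : seq T,
  [/\ size ys = m /\ size zs = m, uniq ys, uniq zs,
     {subset ys <= A} /\ {subset zs <= A} & {in ys & zs, forall y z, e z y}].

(** Sort [W] by trace on [S]: one of the [2 ^ #|S|] classes has more than [m] vertices, all joined
    to the same trace of size at least [m]. *)
Lemma pigeonhole_biclique (A S W : {set T}) m : 0 < m ->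
    S \subset A -> W \subset A -> {in W, forall w, m <= #|[set y in S | e w y]|} ->
    m * 2 ^ #|S| < #|W| ->
  biclique A m.
Proof.
move=> m0 SA WA Wm ltW; pose f w := [set y in S | e w y].
have [Y /andP[YS]] : exists Y, (Y \in powerset S) && (m < #|[set w in W | f w == Y]|).
  apply/existsP; apply: contraLR ltW => /existsPn no; rewrite -leqNgt.
  rewrite -sum1_card (partition_big f (mem (powerset S))) /=; last first.
    by move=> w _; rewrite inE; apply/subsetP => y; rewrite inE => /andP[].
  rewrite mulnC -card_powerset -sum_nat_const; apply: leq_sum => Y YS.
  have := no Y; rewrite YS /= -leqNgt; apply: leq_trans.
  by rewrite -sum1_card; apply: eq_leq; apply: eq_bigl => w; rewrite inE.
move=> ltY.
have [w] : exists w, w \in [set w in W | f w == Y].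
  by apply/set0Pn; rewrite -card_gt0; apply: leq_trans ltY.
rewrite inE => /andP[wW /eqP fw].
have [ys [sy uy yY]] : exists s : seq T, [/\ size s = m, uniq s & {subset s <= Y}].
  by apply: exists_subseq_card; rewrite -fw Wm.
have [zs [sz uz zY]] := exists_subseq_card (ltnW ltY).
exists ys, zs; split=> //.
  split=> [y /yY|z /zY]; first by rewrite -fw inE => /andP[/(subsetP SA)].
  by rewrite inE => /andP[/(subsetP WA)].
move=> y z /yY yY' /zY; rewrite inE => /andP[_ /eqP fz].
by move: yY'; rewrite -fz inE => /andP[].
Qed.

(** If the bound failed, at least [M = 4 N m] vertices would have degree at least [n / (2 N)]. Any
    [M] of them send at least [2 m n] edges into [A], so at least [n / (4 N)] vertices have [m]
    neighbours among them, enough for the pigeonhole. *)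
Lemma Kovari_Sos_Turan (A : {set T}) m N n : symmetric e ->
    0 < m -> 0 < N -> #|T| <= n ->
    4 * N * m * 2 ^ (4 * N * m) < n -> ~ biclique A m ->
  N * (\sum_(v in A) #|[set w in A | e v w]|) <= n ^ 2.
Proof.
move=> es m0 N0 Tn; set M := 4 * N * m => ltn nob; rewrite leqNgt; apply/negP => big.
apply: nob; pose d v := #|[set w in A | e v w]|.
have dn v : d v <= n by apply: leq_trans (max_card _) Tn.
pose S0 := [set v in A | n <= 2 * N * d v].
have An : #|A| <= n by apply: leq_trans (max_card _) Tn.
have n0 : 0 < n by apply: leq_trans ltn.
have S0M : M <= #|S0|.
  have : 2 * N * (\sum_(v in A) d v) <= 2 * N * (#|S0| * n) + n * n.
    apply: leq_trans (_ : \sum_(v in A) (2 * N * (if v \in S0 then n else 0) + n) <= _).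
      rewrite big_distrr /=; apply: leq_sum => v vA.
      rewrite inE vA /=; case: (leqP n (2 * N * d v)) => dv; last by rewrite muln0 add0n ltnW.
      by apply: leq_trans (leq_addr _ _); rewrite leq_mul2l dn orbT.
    rewrite big_split /= sum_nat_const -big_distrr /= leq_add ?leq_mul2r ?An ?orbT //.
    rewrite leq_mul2l -big_mkcondr /= -sum_nat_const; apply/orP; right.
    by apply: eq_leq; apply: eq_bigl => v; rewrite inE; case: (v \in A).
  move=> h; rewrite leqNgt; apply/negP => lM.
  have h1 : n * n < 2 * N * (#|S0| * n).
    by move: h big; rewrite -/(\sum_(v in A) d v) expnS expn1; nia.
  have h2 : n < 2 * N * #|S0| by move: h1; rewrite mulnA ltn_pmul2r.
  have h3 : 2 * N * #|S0| <= 2 * N * M by rewrite leq_mul2l ltnW ?orbT.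
  have h4 : M < 2 ^ M by apply: ltn_expl.
  have h5 : M * M <= M * 2 ^ M by rewrite leq_mul2l ltnW ?orbT.
  by move: h2 h3 h5 ltn; rewrite /M; nia.
have [S [SS0 cS]] := exists_subset_card S0M.
have SA : S \subset A.
  by apply: subset_trans SS0 _; apply/subsetP => v; rewrite inE => /andP[].
pose c w := #|[set y in S | e w y]|.
pose W := [set w in A | m <= c w].
apply: (@pigeonhole_biclique A S W m) => //.
- by apply/subsetP => w; rewrite inE => /andP[].
- by move=> w; rewrite inE => /andP[].
have dc : \sum_(w in A) c w = \sum_(v in S) d v.
  rewrite /c /d; under eq_bigr do rewrite -sum1dep_card big_mkcondr.
  rewrite exchange_big; apply: eq_bigr => v _; rewrite -sum1dep_card [RHS]big_mkcondr.
  by apply: eq_bigr => w _; rewrite es.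
have low : M * n <= 2 * N * \sum_(v in S) d v.
  rewrite -cS -sum_nat_const big_distrr /=; apply: leq_sum => v /(subsetP SS0).
  by rewrite inE => /andP[].
have up : \sum_(w in A) c w <= #|W| * M + n * m.
  apply: leq_trans (_ : \sum_(w in A) ((if w \in W then M else 0) + m) <= _).
    apply: leq_sum => w wA; rewrite inE wA /=; case: (leqP m (c w)) => cw; last exact: ltnW.
    apply: leq_trans (leq_addr _ _); rewrite -cS; apply: subset_leq_card.
    by apply/subsetP => y; rewrite inE => /andP[].
  rewrite big_split /= sum_nat_const leq_add ?leq_mul2r ?An ?orbT //.
  rewrite -big_mkcondr /= -sum_nat_const.
  by apply: eq_leq; apply: eq_bigl => v; rewrite inE; case: (v \in A).
rewrite cS; rewrite dc in up.
have h : n <= 4 * N * #|W|.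
  have : M * n <= 2 * N * (#|W| * M + n * m).
    by apply: leq_trans low _; rewrite leq_mul2l up orbT.
  have : 0 < N * m by rewrite muln_gt0 N0.
  by rewrite /M; nia.
move: (leq_trans ltn h); rewrite /M -mulnA -[4 * N * #|W|]mulnA.
by rewrite -!mulnA !ltn_pmul2l.
Qed.
End Kovari_Sos_Turan.

(** * An almost complete bipartition *)

Local Open Scope ring_scope.

Section RealCardinals.
Variables (R : realType) (T : finType).
Implicit Types (A B : {set T}).

Definition rcard A : R := #|A|%:R.

Lemma rcard_ge0 A : 0 <= rcard A. Proof. exact: ler0n. Qed.

Lemma rcardID A B : rcard A = rcard (A :&: B) + rcard (A :\: B).
Proof. by rewrite /rcard -natrD cardsID. Qed.

Lemma rcardC A : rcard A + rcard (~: A) = #|T|%:R.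
Proof. by rewrite /rcard -natrD cardsC. Qed.

Lemma rcardS A B : A \subset B -> rcard A <= rcard B.
Proof. by move=> AB; rewrite ler_nat subset_leq_card. Qed.

Lemma rcardE A : rcard A = \sum_(i in A) 1.
Proof. by rewrite sumr_const. Qed.

Lemma sum_le_rcard A (f : T -> R) c : {in A, forall i, f i <= c} ->
  \sum_(i in A) f i <= c * rcard A.
Proof.
move=> fc; rewrite rcardE mulr_sumr; apply: ler_sum => i iA.
by rewrite mulr1 fc.
Qed.

Lemma sum_ge_rcard A (f : T -> R) c : {in A, forall i, c <= f i} ->
  c * rcard A <= \sum_(i in A) f i.
Proof.
move=> fc; rewrite rcardE mulr_sumr; apply: ler_sum => i iA.
by rewrite mulr1 fc.
Qed.

Lemma markov_rcard A (f : T -> R) c : {in A, forall i, 0 <= f i} ->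
  c * rcard [set i in A | c < f i] <= \sum_(i in A) f i.
Proof.
move=> f0; apply: le_trans (sum_ge_rcard (f := f) (c := c) _) _.
  by move=> i; rewrite inE => /andP[_ /ltW].
rewrite [X in _ <= X](bigID (fun i => c < f i)) /=.
under eq_bigl => i do rewrite inE.
by rewrite lerDl sumr_ge0 // => i /andP[/f0].
Qed.

Lemma sum_setID A B (f : T -> R) :
  \sum_(i in A) f i = \sum_(i in A :&: B) f i + \sum_(i in A :\: B) f i.
Proof.
rewrite (bigID (mem B)) /=; congr (_ + _); apply: eq_bigl => i; rewrite !inE //.
by rewrite andbC.
Qed.
End RealCardinals.

Lemma common_neighbors_real (R : realType) n (G : rel 'I_n) (Z : {set 'I_n})
    (Y F : seq 'I_n) (m : R) j : 0 <= m ->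
    {in Y, forall y, rcard R (Z :\: nbr G y) <= m} ->
    (size Y)%:R * m + (size F)%:R + j%:R <= rcard R Z ->
  exists rs, [/\ size rs = j, uniq rs, {subset rs <= Z},
    {in rs, forall r, r \notin F} & {in Y & rs, forall y r, G y r}].
Proof.
move=> m0 Ym sz; pose m' := (\max_(y <- Y) #|Z :\: nbr G y|)%N.
have m'm : m'%:R <= m.
  rewrite /m'; elim: (Y) Ym => [|y s IH] Ym; first by rewrite big_nil.
  rewrite big_cons; case: (leqP #|Z :\: nbr G y|) => _.
    by apply: IH => z zs; apply: Ym; rewrite inE zs orbT.
  by apply: Ym; rewrite mem_head.
apply: (@common_neighbors n G Z Y F m' j).
  by move=> y yY; rewrite /m' (big_rem y) //= leq_maxl.
rewrite -(ler_nat R) !natrD natrM; apply: le_trans sz.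
by rewrite !lerD2r ler_wpM2l.
Qed.

Section Bipartition.
Variables (R : realType) (k n : nat) (G : rel 'I_n) (x : 'I_n -> R).
Let lam := lambda1 R G.
Let nr : R := n%:R.
Local Notation rc := (rcard R).
Local Notation N := (nbr G).
Hypotheses (k2 : (2 <= k)%N) (k5 : (k <= 5)%N).
Hypotheses (sG : simple_graph G) (fG : Defs.free (@wheel (2 * k + 1)) G).
Hypothesis maxG : forall H : rel 'I_n, simple_graph H ->
  Defs.free (@wheel (2 * k + 1)) H -> lambda1 R H <= lam.
Hypotheses (n_large : 10 * 400 <= nr) (lam_lo : nr / 2 <= lam).
Hypotheses (x0 : forall i, 0 <= x i) (x1 : forall i, x i <= 1).
Hypothesis ev : forall i, adj_sum G x i = lam * x i.

Lemma adj_sumE v : adj_sum G x v = \sum_(w in N v) x w.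
Proof. by apply: eq_bigl => w; rewrite inE. Qed.

Lemma rc_n (A : {set 'I_n}) : rc A + rc (~: A) = nr.
Proof. by rewrite rcardC card_ord. Qed.

Lemma sum_x_le (A : {set 'I_n}) : \sum_(i in A) x i <= rc A.
Proof. by rewrite -[X in _ <= X]mul1r; apply: sum_le_rcard => i _. Qed.

Lemma no_biclique_in_nbr u : ~ biclique G (N u) k.
Proof.
move=> [ys [zs [[sy sz] uy uz [yN zN] yz]]].
have [Gs _] := sG.
apply: (@no_common_biclique n k G sG u ys zs) => //.
- by apply: leq_trans k2.
- by move=> y /yN; rewrite inE.
- by move=> z /zN; rewrite inE.
- by move=> y z yy zz; rewrite Gs; apply: yz.
Qed.

Let k5r : k%:R <= 5 :> R. Proof. by rewrite (ler_nat R k 5). Qed.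
Let kr0 : 0 <= k%:R :> R. Proof. by rewrite ler0n. Qed.

(* [lra] and [nra] ignore section hypotheses. *)
Ltac facts := have nl := n_large; have ll := lam_lo;
  have k5' := k5r; have k0' := kr0.

Lemma adj_sum_reset (v : 'I_n) (S : {set 'I_n}) :
  adj_sum (reset_nbr G v S) x v = \sum_(w in S :\ v) x w.
Proof. by apply: eq_bigl => w; rewrite /reset_nbr eqxx !inE. Qed.

(** The vertices of a wheel that lie in [S] have a common neighbour in [Z] off the wheel, so
    rewiring [v] to [S] creates no wheel, and extremality compares the two neighbourhood sums. *)
Lemma reset_sum_le (v : 'I_n) (S Z : {set 'I_n}) (m : R) : 0 <= m ->
    {in S, forall y, rc (Z :\: N y) <= m} -> 11 * m + 12 <= rc Z ->
  \sum_(w in S :\ v) x w <= lam * x v.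
Proof.
facts.
move=> m0 Sm cZ; rewrite -adj_sum_reset.
have sH := reset_nbr_simple v S sG.
apply: (@modified_neighborhood_sum_le _ _ G (reset_nbr G v S)) => //.
- apply: maxG => //; apply: reset_nbr_free => // F sF.
  pose Y := [seq y <- F | y \in S].
  have [||rs [s1 _ _ rF Yr]] := @common_neighbors_real R n G Z Y F m 1 m0.
  + by move=> y; rewrite mem_filter => /andP[/Sm].
  (* A wheel has [2 k + 1 <= 11] vertices, hence [11 m] for missed vertices, 11 for avoiding the
     wheel and 1 for the vertex sought. *)
  + apply: le_trans cZ.
    have sY : (size Y)%:R <= (size F)%:R :> R by rewrite ler_nat size_filter count_size.
    have : (size F)%:R <= 11 :> R by rewrite sF (ler_nat R _ 11); lia.
    by move: sY; nra.
  case: rs s1 rF Yr => [//|b rs] _ rF Yr; exists b; split.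
    by apply: rF; rewrite mem_head.
  have [Gs _] := sG.
  move=> t tF tS; rewrite Gs; apply: Yr; last exact: mem_head.
  by rewrite mem_filter tS.
- rewrite -/lam; lra.
- by move=> i j /negPf iv /negPf jv; rewrite /reset_nbr iv jv.
Qed.

Section FromMaxVertex.
Variable u : 'I_n.
Hypothesis xu : x u = 1.
Let B := N u.
Let A := ~: B.
Hypothesis sparse : \sum_(v in B) rc (N v :&: B) <= (nr / 400) ^+ 2.

(** Expand [lam^2 x_u] over 2-walks from [u]. Walks ending in [B] are bounded by [sparse], and those
    ending at [w] in [A] have their middle vertex in both neighbourhoods. *)
Lemma lam_sqr_le : lam ^+ 2 <= (nr / 400) ^+ 2 + \sum_(w in A) rc (N w :&: B) * x w.
Proof.
facts.
have [Gs _] := sG.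
have -> : lam ^+ 2 = \sum_(v in B) \sum_(w in N v) x w.
  have -> : lam ^+ 2 = lam * (lam * x u) by rewrite xu; ring.
  rewrite -ev adj_sumE mulr_sumr; apply: eq_bigr => v _.
  by rewrite -ev adj_sumE.
under eq_bigr => v _ do rewrite (sum_setID _ B).
rewrite big_split /=; apply: lerD.
  apply: le_trans sparse; apply: ler_sum => v _; exact: sum_x_le.
rewrite le_eqVlt; apply/orP; left; apply/eqP.
rewrite (exchange_big_dep (mem A)) /=; last by move=> v w _; rewrite !inE => /andP[].
apply: eq_bigr => w wA; rewrite rcardE mulr_suml; apply: eq_big => [v|v _]; last by rewrite mul1r.
by move: wA; rewrite !inE (Gs v w) => ->; rewrite /= andbC.
Qed.

(** Weighted non-adjacency: 1 for a non-edge, and small only for an edge with [x w] near 1. *)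
Let gap w v : R := 1 - (G w v)%:R * x w.

Lemma gap_ge0 w v : 0 <= gap w v.
Proof. by rewrite /gap; have := x0 w; have := x1 w; case: (G w v) => /=; lra. Qed.

Lemma sum_gap w : \sum_(v in B) gap w v = rc B - rc (N w :&: B) * x w.
Proof.
facts.
rewrite /gap big_split /= -rcardE; congr (_ + _).
rewrite sumrN -mulr_suml rcardE; congr (- (_ * _)).
rewrite big_mkcond [RHS]big_mkcond; apply: eq_bigr => v _.
by rewrite !inE; case: (G u v); case: (G w v).
Qed.

(** The total gap is [|A| |B|] minus the sum in [lam_sqr_le], which is at least [n^2/4 - (n/400)^2].
    As [|A| |B| = n^2/4 - (|A| - |B|)^2/4], both bounds follow. *)
Lemma total_gap : \sum_(w in A) \sum_(v in B) gap w v <= (nr / 400) ^+ 2 /\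
  (rc A - rc B) ^+ 2 <= 4 * (nr / 400) ^+ 2.
Proof.
facts.
under eq_bigr => w _ do rewrite sum_gap.
rewrite big_split /= sumrN sumr_const -mulr_natl -/(rc A).
have := lam_sqr_le; have := rc_n B; rewrite -/A.
set S := \sum_(w in A) _ => sum_n lS.
have l2 : nr ^+ 2 / 4 <= lam ^+ 2.
  have -> : nr ^+ 2 / 4 = (nr / 2) ^+ 2 by field.
  by rewrite ler_pXn2r ?nnegrE //; lra.
have SAB : S <= rc A * rc B.
  rewrite /S mulrC; apply: sum_le_rcard => w _.
  have := rcardS R (subsetIr (N w) B); have := x0 w; have := x1 w.
  have := rcard_ge0 R (N w :&: B); nra.
have sq := sqr_ge0 (rc A - rc B).
split; nra.
Qed.

Lemma part_sizes : [/\ nr / 2 - nr / 400 <= rc A, rc A <= nr / 2 + nr / 400,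
  nr / 2 - nr / 400 <= rc B & rc B <= nr / 2 + nr / 400].
Proof.
facts.
have [_ sq] := total_gap; have s := rc_n B; rewrite -/A in s.
have : `|rc A - rc B| <= nr * (2 / 400).
  rewrite -(@ler_pXn2r R 2) ?nnegrE //; last by lra.
  by rewrite real_normK ?num_real //; apply: le_trans sq _; rewrite exprMn; nra.
by rewrite ler_norml => /andP[h1 h2]; split; lra.
Qed.

(** Typical vertices. Since the total gap is at most [(n/400)^2], Markov's inequality leaves at most
    [n/400] others on each side. *)
Let A' := [set w in A | \sum_(v in B) gap w v <= nr / 400].
Let B' := [set v in B | \sum_(w in A) gap w v <= nr / 400].

Lemma rcard_atypical : rc (A :\: A') <= nr / 400 /\ rc (B :\: B') <= nr / 400.
Proof.
facts.
have [tg _] := total_gap.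
have e0 : 0 < nr / 400 by lra.
split; rewrite -(ler_pM2l e0).
  have -> : A :\: A' = [set w in A | nr / 400 < \sum_(v in B) gap w v].
    by apply/setP => w; rewrite !inE ltNge; case: (G u w) => //=; rewrite andbT.
  apply: le_trans (markov_rcard _ _) _.
    by move=> w _; apply: sumr_ge0 => v _; apply: gap_ge0.
  by apply: le_trans tg _; nra.
have -> : B :\: B' = [set v in B | nr / 400 < \sum_(w in A) gap w v].
  by apply/setP => w; rewrite !inE ltNge; case: (G u w) => //=; rewrite andbT.
apply: le_trans (markov_rcard _ _) _.
  by move=> w _; apply: sumr_ge0 => v _; apply: gap_ge0.
by rewrite exchange_big; apply: le_trans tg _; nra.
Qed.

Lemma typical_farP w : w \in A' ->
  [/\ w \in A, rc (B :\: N w) <= nr / 400 & 1 - 3 / 400 <= x w].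
Proof.
facts.
rewrite inE => /andP[wA gw]; have [_ _ Blo _] := part_sizes.
have ID := rcardID R B (N w); rewrite setIC in ID.
have := gw; rewrite sum_gap.
have := x0 w; have := x1 w; have := rcard_ge0 R (N w :&: B).
have := rcard_ge0 R (B :\: N w).
split => //; nra.
Qed.

(** The gap weighs only the endpoint in [A], so unlike [typical_farP] this gives no bound on [x v];
    that comes from [x_lower]. *)
Lemma typical_nearP v : v \in B' -> v \in B /\ rc (A :\: N v) <= nr / 400.
Proof.
facts.
rewrite inE => /andP[vB gv]; split => //; apply: le_trans gv.
have [Gs _] := sG.
rewrite [X in _ <= X](sum_setID _ (N v)) rcardE.
rewrite -[X in X <= _]add0r; apply: lerD.
  by apply: sumr_ge0 => w _; apply: gap_ge0.
apply: ler_sum => w; rewrite !inE Gs /gap => /andP[/negPf -> _].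
by rewrite mul0r subr0.
Qed.

Lemma lam_hi : lam <= nr / 2 + nr / 400.
Proof.
facts.
have lam0 : 0 <= lam by lra.
have := lam_sqr_le; have := rc_n B; rewrite -/A.
have : \sum_(w in A) rc (N w :&: B) * x w <= rc B * rc A.
  apply: sum_le_rcard => w _.
  have := rcardS R (subsetIr (N w) B); have := x0 w; have := x1 w.
  have := rcard_ge0 R (N w :&: B); nra.
move=> h1 h2 h3; rewrite -(@ler_pXn2r R 2) ?nnegrE //; last by lra.
have := sqr_ge0 (rc A - rc B); nra.
Qed.

Lemma rcard_typical_far : nr / 2 - 2 * nr / 400 <= rc A'.
Proof.
facts.
have [h1 _] := rcard_atypical; have [h2 _ _ _] := part_sizes.
have ID := rcardID R A A'; move: ID.
have -> : A :&: A' = A' by apply/setIidPr/subsetP => w; rewrite inE => /andP[].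
lra.
Qed.

Lemma rcard_typical_near : nr / 2 - 2 * nr / 400 <= rc B'.
Proof.
facts.
have [_ h1] := rcard_atypical; have [_ _ h2 _] := part_sizes.
have ID := rcardID R B B'; move: ID.
have -> : B :&: B' = B' by apply/setIidPr/subsetP => w; rewrite inE => /andP[].
lra.
Qed.

Lemma typical_near_sub : B' \subset B.
Proof. by apply/subsetP => w; rewrite inE => /andP[]. Qed.

Lemma typical_far_sub : A' \subset A.
Proof. by apply/subsetP => w; rewrite inE => /andP[]. Qed.

(** Compare with rewiring [v] to [A'], whose vertices have entries near 1 and miss few vertices of
    [B']. *)
Lemma x_lower v : nr / 2 - 4 * nr / 400 <= lam * x v /\ 1 - 10 / 400 <= x v.
Proof.
facts.
have h : nr / 2 - 4 * nr / 400 <= lam * x v.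
  have := @reset_sum_le v A' B' (nr / 400).
  have e0 : 0 <= nr / 400 by lra.
  move=> /(_ e0) h; apply: le_trans (h _ _); last 2 first.
  - move=> y /typical_farP [_ yB _]; apply: le_trans yB; apply: rcardS; apply: setSD.
    exact: typical_near_sub.
  - by have := rcard_typical_near; lra.
  apply: le_trans (sum_ge_rcard (c := 1 - 3 / 400) _); last first.
    by move=> w; rewrite inE => /andP[_ /typical_farP[]].
  have := rcard_typical_far; have ID := rcardID R A' [set v].
  have : rc (A' :&: [set v]) <= 1.
    by apply: le_trans (rcardS R (subsetIr _ _)) _; rewrite /rcard cards1.
  by lra.
split => //; have := lam_hi; have := x0 v; have := x1 v; nra.
Qed.

Lemma degree_lower v : nr / 2 - 4 * nr / 400 <= rc (N v).
Proof.
facts.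
have [h _] := x_lower v; apply: le_trans h _.
by rewrite -ev adj_sumE sum_x_le.
Qed.

(** Otherwise [k] neighbours in [A'] have [k] common neighbours in [N v :&: B']: the cost
    [k n/400 + k] is at most [6 n/400]. *)
Lemma nbr_dichotomy v : (k <= #|N v :&: A'|)%N -> rc (N v :&: B') <= 6 * nr / 400.
Proof.
facts.
move=> /exists_subseq_card [ys [sy uy yA]]; rewrite leNgt; apply/negP => big.
have e0 : 0 <= nr / 400 by lra.
have [||rs [sr ur rZ _ yr]] := @common_neighbors_real R n G (N v :&: B') ys [::] (nr / 400) k e0.
- move=> y /yA; rewrite inE => /andP[_ /typical_farP [_ yB _]]; apply: le_trans yB.
  by apply: rcardS; apply: setSD; apply: subset_trans (subsetIr _ _) typical_near_sub.
- by rewrite sy /=; nra.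
apply: (@no_common_biclique n k G sG v ys rs) => //.
- by apply: leq_trans k2.
- by move=> y /yA; rewrite !inE => /andP[].
- by move=> y /rZ; rewrite !inE => /andP[].
Qed.

Definition almost_complete (X : {set 'I_n}) :=
  [/\ nr / 2 - 2 * nr / 400 <= rc X, nr / 2 - 2 * nr / 400 <= rc (~: X),
     {in X, forall v, rc (~: X :\: N v) <= 14 * nr / 400}
   & {in ~: X, forall v, rc (X :\: N v) <= 14 * nr / 400}].

(** Every degree is near [n/2] or more, so by [nbr_dichotomy] a vertex sees almost all of [A'] or
    almost all of [B']; sort the vertices by this. Then [A'] falls into [X] and [B'] into its
    complement. *)
Lemma almost_complete_exists : exists X, almost_complete X.
Proof.
facts.
pose X := [set v | nr / 4 <= rc (N v :&: B')].
have few (Z : {set 'I_n}) : (#|Z| < k)%N -> rc Z <= 5.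
  by move=> h; apply: le_trans k5'; rewrite ler_nat ltnW.
have deg v : nr / 2 - 6 * nr / 400 <= rc (N v :&: A') + rc (N v :&: B').
  have := degree_lower v.
  rewrite (rcardID R (N v) A) (rcardID R (N v :&: A) A') (rcardID R (N v :\: A) B').
  have [h1 h2] := rcard_atypical.
  have := rcardS R (subsetIr (N v) A); have := rcardS R (subsetIr (N v) B).
  have s1 : rc ((N v :&: A) :\: A') <= rc (A :\: A') by apply/rcardS/setSD/subsetIr.
  have s2 : rc ((N v :\: A) :\: B') <= rc (B :\: B').
    by apply/rcardS/setSD; rewrite /A setDE setCK subsetIr.
  have s3 : rc (N v :&: A :&: A') <= rc (N v :&: A').
    by apply/rcardS/setSI/subsetIl.
  have s4 : rc ((N v :\: A) :&: B') <= rc (N v :&: B').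
    by apply/rcardS/setSI/subsetDl.
  by lra.
have inX v : v \in X -> nr / 2 - 7 * nr / 400 <= rc (N v :&: B').
  rewrite inE => vB; have := deg v; case: (leqP k #|N v :&: A'|) => kA.
    by have := nbr_dichotomy kA; lra.
  by have := few _ kA; lra.
have ninX v : v \notin X -> nr / 2 - 12 * nr / 400 <= rc (N v :&: A').
  rewrite inE -ltNge => vB; have := deg v; case: (leqP k #|N v :&: A'|) => kA.
    by have := nbr_dichotomy kA; lra.
  by have := few _ kA; lra.
have rA := rcard_typical_far; have rB := rcard_typical_near.
have sA : A' \subset X.
  apply/subsetP => w wA; rewrite inE; have [_ wB _] := typical_farP wA.
  have := rcardID R B' (N w); rewrite setIC.
  have : rc (B' :\: N w) <= rc (B :\: N w) by apply/rcardS/setSD/typical_near_sub.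
  by lra.
have sB : B' \subset ~: X.
  apply/subsetP => w wB; rewrite !inE -ltNge; have [_ wA] := typical_nearP wB.
  have := rcardID R A' (N w); rewrite setIC.
  have : rc (A' :\: N w) <= rc (A :\: N w) by apply/rcardS/setSD/typical_far_sub.
  move=> h1 h2; case: (leqP k #|N w :&: A'|) => kA.
    by have := nbr_dichotomy kA; lra.
  by have := few _ kA; lra.
have cX := rc_n X; have rX := rcardS R sA; have rX' := rcardS R sB.
exists X; split; [lra|lra| |].
- move=> v vX; have := inX v vX; have := rcardID R (~: X) (N v).
  have : rc (N v :&: B') <= rc (~: X :&: N v) by rewrite setIC; apply/rcardS/setSI.
  by lra.
- move=> v; rewrite inE => vX; have := ninX v vX; have := rcardID R X (N v).
  have : rc (N v :&: A') <= rc (X :&: N v) by rewrite setIC; apply/rcardS/setSI.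
  by lra.
Qed.
End FromMaxVertex.

Lemma almost_completeC X : almost_complete X -> almost_complete (~: X).
Proof. by case=> h1 h2 h3 h4; split; rewrite ?setCK. Qed.

(** Any [k] inner neighbours of [v] have [k] common neighbours among the outer neighbours of [v], a
    forbidden [K_{k,k}]. *)
Lemma inner_degree_le X v : almost_complete X -> v \in X -> (#|N v :&: X| <= k.-1)%N.
Proof.
facts.
move=> [sX sX' mX mX'] vX; rewrite -ltnS prednK; last by apply: leq_trans k2.
rewrite ltnNge; apply/negP => /exists_subseq_card [ys [sy uy yX]].
have e0 : 0 <= 14 * nr / 400 by lra.
have := mX v vX; have ID := rcardID R (~: X) (N v) => mv.
have [||rs [sr ur rZ _ yr]] := @common_neighbors_real R n G (~: X :&: N v) ys [::] (14 * nr / 400) k e0.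
- move=> y /yX; rewrite inE => /andP[_ yX']; apply: le_trans (mX y yX').
  by apply/rcardS/setSD/subsetIl.
- by rewrite sy /=; nra.
apply: (@no_common_biclique n k G sG v ys rs) => //.
- by apply: leq_trans k2.
- by move=> y /yX; rewrite !inE => /andP[].
- by move=> y /rZ; rewrite !inE => /andP[].
Qed.

(** Compare with rewiring [v] to the whole other side. Common neighbours cancel, so the missing
    weight is at most the inner weight. *)
Lemma missing_le X v : almost_complete X -> (forall v, 1 - 10 / 400 <= x v) ->
  v \in X -> (#|~: X :\: N v| <= #|N v :&: X|)%N.
Proof.
facts.
move=> aX xlo vX; have [sX sX' mX mX'] := aX.
have e0 : 0 <= 14 * nr / 400 by lra.
have := @reset_sum_le v (~: X) X (14 * nr / 400) e0 mX'.
have -> : ~: X :\ v = ~: X.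
  apply/setP => w; rewrite !inE; case: eqP => // ->.
  by rewrite vX.
move=> /(_ ltac:(lra)); rewrite -ev adj_sumE (sum_setID (N v) X) (sum_setID (~: X) (N v)).
have -> : N v :\: X = ~: X :&: N v by rewrite setDE setIC.
rewrite addrC lerD2r => h.
have h1 : (1 - 10 / 400) * rc (~: X :\: N v) <= rc (N v :&: X).
  apply: le_trans (sum_x_le _); apply: le_trans h.
  by apply: sum_ge_rcard => w _; apply: xlo.
have dk := inner_degree_le aX vX.
have d4 : rc (N v :&: X) <= 4.
  by rewrite /rcard (ler_nat R _ 4); apply: leq_trans dk _; move: k5; lia.
(* Entries at least 39/40 and inner degree at most 4 leave an error below 1, and both counts are
   integers. *)
rewrite -ltnS -(ltr_nat R) -natr1 -/(rc _) -/(rc _); lra.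
Qed.
End Bipartition.

(** * Wheels in a tight bipartition *)

Local Open Scope nat_scope.

Section TightSplit.
Variables (n : nat) (G : rel 'I_n) (k : nat).
Hypotheses (sG : simple_graph G) (fG : Defs.free (@wheel (2 * k + 1)) G).
Hypotheses (k4 : 4 <= k) (k5 : k <= 5).
Implicit Types (X : {set 'I_n}).
Local Notation N := (nbr G).

Definition tight X := [/\ 100 <= #|X|, 100 <= #|~: X|,
  {in X, forall v, #|N v :&: X| <= k.-1 /\ #|~: X :\: N v| <= k.-1} &
  {in ~: X, forall v, #|N v :&: ~: X| <= k.-1 /\ #|X :\: N v| <= k.-1}].

Lemma tightC X : tight X -> tight (~: X).
Proof. by case=> h1 h2 h3 h4; split; rewrite ?setCK. Qed.

Definition deg_ge X j := [set v in X | j <= #|N v :&: X|].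

(** A vertex is bad if it lies in [F] or misses some [z]. Each bad vertex excludes itself and its at
    most [k - 1] inner neighbours, and [S] is larger than all that is excluded. *)
Lemma rich_vertex X (S : {set 'I_n}) (Z F : seq 'I_n) : tight X -> S \subset X ->
    {subset Z <= ~: X} -> (size F + size Z * k.-1) * k < #|S| ->
  exists2 v, v \in S & forall y, y \in X -> y = v \/ G v y ->
    y \notin F /\ {in Z, forall z, G z y}.
Proof.
move=> [_ _ tX tX'] SX ZX big; have [Gs _] := sG.
pose Bad := [set y in X | (y \in F) || has (fun z => ~~ G z y) Z].
have cB : #|Bad| <= size F + size Z * k.-1.
  apply: leq_trans (_ : #|[set y in F] :|: \bigcup_(z <- Z) (X :\: N z)| <= _).
    apply: subset_leq_card; apply/subsetP => y; rewrite !inE => /andP[yX].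
    case/orP => [->//|/hasP[z zZ Gzy]]; apply/orP; right.
    by rewrite (big_rem z) //= !inE Gzy yX.
  apply: leq_trans (leq_card_setU _ _) _; apply: leq_add.
    by rewrite cardsE card_size.
  elim: Z ZX {big Bad} => [|z Z IH] ZX; first by rewrite big_nil cards0.
  rewrite big_cons mulSn; apply: leq_trans (leq_card_setU _ _) _.
  apply: leq_add; first by case: (tX' z); rewrite // ZX ?mem_head.
  by apply: IH => y yZ; apply: ZX; rewrite inE yZ orbT.
pose Bad2 := Bad :|: \bigcup_(y in Bad) (N y :&: X).
have cB2 : #|Bad2| <= #|Bad| * k.
  have -> : #|Bad| * k = #|Bad| + #|Bad| * k.-1.
    by rewrite -{1}(prednK (n := k)) ?mulnS //; apply: leq_trans k4.
  apply: leq_trans (leq_card_setU _ _) _; rewrite leq_add2l.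
  apply: leq_trans (_ : \sum_(y in Bad) #|N y :&: X| <= _).
    elim/big_rec2: _ => [|y m A yB IH]; first by rewrite cards0.
    by apply: leq_trans (leq_card_setU _ _) _; rewrite leq_add2l.
  rewrite -sum_nat_const; apply: leq_sum => y.
  by rewrite inE => /andP[yX _]; case: (tX y yX).
have [v vS vB] : exists2 v, v \in S & v \notin Bad2.
  apply/exists_inP; apply: contraLR big => /exists_inPn h.
  rewrite -leqNgt; apply: leq_trans (_ : #|Bad2| <= _); last first.
    by apply: leq_trans cB2 _; rewrite leq_mul2r cB orbT.
  apply: subset_leq_card; apply/subsetP => y /h; by rewrite negbK.
exists v => // y yX yv; have vX := subsetP SX v vS.
have nB : y \notin Bad.
  apply: contra vB => yB; rewrite inE; case: yv => [<-|Gvy]; first by rewrite yB.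
  apply/orP; right; apply/bigcupP; exists y => //.
  by rewrite !inE Gs Gvy vX.
move: nB; rewrite inE yX /= negb_or => /andP[yF /hasPn h]; split => // z zZ.
by have := h z zZ; rewrite negbK.
Qed.

(** The embeddings exclude at most [(7 + 5 * 4) * 5 = 135] vertices, so 200 always leaves a
    choice. *)
Definition rich X j := 200 <= #|deg_ge X j|.

Lemma rich_bound X j (a b : nat) : rich X j -> a <= 7 -> b <= 5 ->
  (a + b * k.-1) * k < #|deg_ge X j|.
Proof.
move=> rX a7 b5; apply: leq_trans rX.
have : (a + b * k.-1) * k <= (7 + 5 * 4) * 5.
  apply: leq_mul => //; apply: leq_add => //; apply: leq_mul => //; lia.
by lia.
Qed.

Lemma rich_hub X j (Z : seq 'I_n) : tight X -> {subset Z <= ~: X} ->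
    rich X j -> size Z <= 5 ->
  exists v ys, [/\ v \in X, size ys = j /\ uniq ys, {subset ys <= N v :&: X}
    & {in v :: ys, forall y, {in Z, forall z, G z y}}].
Proof.
move=> tX ZX rX sZ; have big := rich_bound rX (leq0n 7 : size ([::] : seq 'I_n) <= 7) sZ.
have sub : deg_ge X j \subset X.
  by apply/subsetP => v; rewrite inE => /andP[].
have [v] := @rich_vertex X (deg_ge X j) Z [::] tX sub ZX big.
rewrite inE => /andP[vX /exists_subseq_card [ys [sy uy yN]]] vP.
exists v, ys; split => // y; rewrite inE => /orP[/eqP ->|yy].
  by case: (vP v vX (or_introl erefl)).
have := yN y yy; rewrite !inE => /andP[Gvy yX].
by case: (vP y yX (or_intror Gvy)).
Qed.

Definition segment X (Z F p : seq 'I_n) := [/\ sorted G p, uniq p, {subset p <= X},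
  {in p, forall y, y \notin F} & {in Z & p, forall z y, G z y}].

Lemma rich_edge X (Z F : seq 'I_n) : tight X -> {subset Z <= ~: X} ->
    rich X 1 -> size F <= 7 -> size Z <= 5 ->
  exists2 p, size p = 2 & segment X Z F p.
Proof.
move=> tX ZX rX sF sZ; have big := rich_bound rX sF sZ.
have sub : deg_ge X 1 \subset X.
  by apply/subsetP => v; rewrite inE => /andP[].
have [v] := @rich_vertex X _ Z F tX sub ZX big; have [Gs Gi] := sG.
rewrite inE => /andP[vX]; rewrite card_gt0 => /set0Pn [w].
rewrite !inE => /andP[Gvw wX] vP; exists [:: v; w] => //.
have pP y : y \in [:: v; w] -> [/\ y \in X, y \notin F & {in Z, forall z, G z y}].
  rewrite !inE => /orP[/eqP ->|/eqP ->].
    by have [] := vP v vX (or_introl erefl).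
  by have [] := vP w wX (or_intror Gvw).
split=> [||y /pP[]|y /pP[]|z y zZ /pP[_ _]] //; last exact.
- by rewrite /= Gvw.
- by rewrite /= inE andbT; apply: contraTneq Gvw => ->; rewrite Gi.
Qed.

Lemma two_neighbors X v : 1 < #|N v :&: X| -> exists a b,
  [/\ a != b, a \in X, b \in X, G v a & G v b].
Proof.
by case/card_gt1P => a [b []]; rewrite !inE => /andP[va aX] /andP[vb bX] ab; exists a, b.
Qed.

Lemma rich_path3 X (Z F : seq 'I_n) : tight X -> {subset Z <= ~: X} ->
    rich X 2 -> size F <= 7 -> size Z <= 5 ->
  exists2 p, size p = 3 & segment X Z F p.
Proof.
move=> tX ZX rX sF sZ; have big := rich_bound rX sF sZ.
have sub : deg_ge X 2 \subset X.
  by apply/subsetP => v; rewrite inE => /andP[].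
have [v] := @rich_vertex X _ Z F tX sub ZX big; have [Gs Gi] := sG.
rewrite inE => /andP[vX] /two_neighbors [a [b [ab aX bX va vb]]] vP.
exists [:: a; v; b] => //.
have pP y : y \in [:: a; v; b] -> [/\ y \in X, y \notin F & {in Z, forall z, G z y}].
  rewrite !inE => /or3P[/eqP ->|/eqP ->|/eqP ->].
  - by have [] := vP a aX (or_intror va).
  - by have [] := vP v vX (or_introl erefl).
  - by have [] := vP b bX (or_intror vb).
split=> [||y /pP[]|y /pP[]|z y zZ /pP[_ _]] //; last exact.
- by rewrite /= Gs va vb.
- rewrite /= !inE negb_or ab !andbT.
  by apply/andP; split; [apply: contraTneq va | apply: contraTneq vb] => ->; rewrite Gi.
Qed.

(* The rim passes through the [ys] and the given segments of [~: X]; missing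
   segments are filled with single common neighbours. *)
Lemma no_hub_with_segments X v (ys : seq 'I_n) (ps : seq (seq 'I_n)) : tight X ->
    v \in X -> {subset ys <= N v :&: X} -> uniq ys -> 0 < size ys <= 5 ->
    {in ps, forall p, sorted G p /\ p != [::]} -> uniq (flatten ps) ->
    {subset flatten ps <= ~: X} ->
    {in v :: ys & flatten ps, forall y r, G y r} ->
    size ps <= size ys ->
    size (flatten ps) + (size ys - size ps) = 2 * k - size ys -> False.
Proof.
move=> [cX cX' tX tX'] vX yX uy /andP[sy0 sy5] pP up pX ypG sp sz.
have fsz : size (flatten ps) <= 10 by lia.
have [||rs [sr ur rX rF yr]] :=
  @common_neighbors n G (~: X) (v :: ys) (flatten ps) k.-1 (size ys - size ps).
- move=> y; rewrite inE => /orP[/eqP ->|/yX]; first by case: (tX v vX).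
  by rewrite inE => /andP[_ /tX[]].
- apply: leq_trans cX'; rewrite /=.
  have : (size ys).+1 * k.-1 <= 6 * 4 by apply: leq_mul; lia.
  by lia.
have fl : flatten [seq [:: r] | r <- rs] = rs.
  by rewrite -[RHS]map_id; elim: (rs) => //= a l ->.
apply: fG; apply: (@wheel_of_segments n k G sG v ys (ps ++ [seq [:: r] | r <- rs])).
- by rewrite size_cat size_map sr subnKC.
- apply/allP => p; rewrite mem_cat => /orP[/pP[]//|/mapP[r _ ->]] //.
- apply/allP => p; rewrite mem_cat => /orP[/pP[]//|/mapP[r _ ->]] //.
- by [].
- by rewrite flatten_cat fl size_cat sr sz; lia.
- by [].
- rewrite flatten_cat fl cat_uniq up ur andbT; apply/hasPn => r /rF.
  by [].
- by move=> y /yX; rewrite !inE => /andP[].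
- move=> r; rewrite flatten_cat fl mem_cat => /orP[rp|rr].
    by apply: ypG => //; apply: mem_head.
  by apply: yr => //; apply: mem_head.
move=> y r yy; rewrite flatten_cat fl mem_cat => /orP[rp|rr].
  by apply: ypG => //; rewrite inE yy orbT.
by apply: yr => //; rewrite inE yy orbT.
Qed.

Lemma hub_sub X v (ys : seq 'I_n) : v \in X -> {subset ys <= N v :&: X} ->
  {subset v :: ys <= ~: ~: X}.
Proof.
move=> vX yX y; rewrite inE setCK => /orP[/eqP ->//|/yX].
by rewrite inE => /andP[].
Qed.

(** Hub [v], with [k - 1] inner neighbours on the rim. The other [k + 1] rim vertices form [k - 1]
    segments: two edges and [k - 3] single vertices. *)
Lemma no_full_degree X v : tight X -> rich (~: X) 1 -> v \in X ->
  k.-1 <= #|N v :&: X| -> False.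
Proof.
move=> tX rX vX /exists_subseq_card [ys [sy uy yX]].
have hs := hub_sub vX yX.
have sZ : size (v :: ys) <= 5 by rewrite /= sy; lia.
have [p1 s1 [o1 u1 x1 _ g1]] := @rich_edge _ _ [::] (tightC tX) hs rX isT sZ.
have [|p2 s2 [o2 u2 x2 f2 g2]] := @rich_edge _ _ p1 (tightC tX) hs rX _ sZ.
  by rewrite s1.
apply: (@no_hub_with_segments X v ys [:: p1; p2]) => //.
- by rewrite sy; move: k4 k5; clear; lia.
- by move=> p; rewrite !inE => /orP[] /eqP ->; rewrite -size_eq0 ?s1 ?s2.
- by rewrite /= cats0 cat_uniq u1 u2 andbT; apply/hasPn => r /f2.
- by move=> r; rewrite /= cats0 mem_cat => /orP[/x1|/x2].
- move=> y r yy; rewrite /= cats0 mem_cat => /orP[] rr; [exact: g1 | exact: g2].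
- by rewrite sy /=; move: k4 k5; clear; lia.
- by rewrite /= cats0 size_cat s1 s2 sy; move: k4 k5; clear; lia.
Qed.

(** With [k - 2] inner neighbours on the rim, [k + 2] further vertices are needed in [k - 2]
    segments: two paths on 3 vertices and [k - 4] single vertices. *)
Lemma no_degree_rich2 X v : tight X -> rich (~: X) 2 -> v \in X ->
  k.-2 <= #|N v :&: X| -> False.
Proof.
move=> tX rX vX /exists_subseq_card [ys [sy uy yX]].
have hs := hub_sub vX yX.
have sZ : size (v :: ys) <= 5 by rewrite /= sy; lia.
have [p1 s1 [o1 u1 x1 _ g1]] := @rich_path3 _ _ [::] (tightC tX) hs rX isT sZ.
have [|p2 s2 [o2 u2 x2 f2 g2]] := @rich_path3 _ _ p1 (tightC tX) hs rX _ sZ.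
  by rewrite s1.
apply: (@no_hub_with_segments X v ys [:: p1; p2]) => //.
- by rewrite sy; move: k4 k5; clear; lia.
- by move=> p; rewrite !inE => /orP[] /eqP ->; rewrite -size_eq0 ?s1 ?s2.
- by rewrite /= cats0 cat_uniq u1 u2 andbT; apply/hasPn => r /f2.
- by move=> r; rewrite /= cats0 mem_cat => /orP[/x1|/x2].
- move=> y r yy; rewrite /= cats0 mem_cat => /orP[] rr; [exact: g1 | exact: g2].
- by rewrite sy /=; move: k4; clear; lia.
- by rewrite /= cats0 size_cat s1 s2 sy /=; move: k4; clear; lia.
Qed.

Lemma path3_of_degree2 X w : 2 <= #|N w :&: X| -> w \in X -> exists p,
  [/\ size p = 3, sorted G p, uniq p & {subset p <= X}].
Proof.
have [Gs Gi] := sG => /two_neighbors [a [b [ab aX bX wa wb]]] wX.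
exists [:: a; w; b]; split=> //.
- by rewrite /= Gs wa wb.
- rewrite /= !inE negb_or ab !andbT.
  by apply/andP; split; [apply: contraTneq wa | apply: contraTneq wb] => ->; rewrite Gi.
- by move=> y; rewrite !inE => /or3P[] /eqP ->.
Qed.

(** Three inner neighbours of a hub in [X] separate segments of sizes 3, 2, 2, making a rim of 10.
    The path through [w] is given, so the hub is chosen after it. *)
Lemma no_rich3_degree2 X w : k = 5 -> tight X -> rich X 3 -> rich (~: X) 1 ->
  w \in ~: X -> 2 <= #|N w :&: ~: X| -> False.
Proof.
move=> k_eq tX r3 r1 wX /path3_of_degree2 /(_ wX) [p0 [s0 o0 u0 x0]].
have [||v [ys [vX [sy uy] yX g0]]] := @rich_hub X 3 p0 tX _ r3.
- exact: x0.
- by rewrite s0.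
have hs := hub_sub vX yX.
have sZ : size (v :: ys) <= 5 by rewrite /= sy.
have [|p1 s1 [o1 u1 x1 f1 g1]] := @rich_edge _ _ p0 (tightC tX) hs r1 _ sZ.
  by rewrite s0.
have [|p2 s2 [o2 u2 x2 f2 g2]] := @rich_edge _ _ (p0 ++ p1) (tightC tX) hs r1 _ sZ.
  by rewrite size_cat s0 s1.
have [Gs Gi] := sG.
apply: (@no_hub_with_segments X v ys [:: p0; p1; p2]) => //.
- by rewrite sy.
- by move=> p; rewrite !inE => /or3P[] /eqP ->; rewrite -size_eq0 ?s0 ?s1 ?s2.
- rewrite /= cats0 catA !cat_uniq u0 u1 u2 !andbT.
  by apply/andP; split; apply/hasPn => r; [move/f1 | move/f2].
- by move=> r; rewrite /= cats0 !mem_cat => /or3P[/x0|/x1|/x2].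
- move=> y r yy; rewrite /= cats0 !mem_cat => /or3P[] rr; [|exact: g1|exact: g2].
  by rewrite Gs; apply: g0.
- by rewrite sy.
- by rewrite /= cats0 !size_cat s0 s1 s2 sy k_eq.
Qed.

(** A hub with [k - 1] inner neighbours needs [k + 1] further rim vertices in [k - 1] segments. Two
    distinct edges save the needed two segments, as a path on 3 vertices if they meet and as two
    segments otherwise. *)
Lemma no_two_edges X a b c d : tight X -> rich X k.-1 ->
  [/\ a \in ~: X, b \in ~: X, c \in ~: X & d \in ~: X] -> G a b -> G c d ->
  (a == c) && (b == d) = false -> (a == d) && (b == c) = false -> False.
Proof.
move=> tX rX [aX bX cX dX] ab cd ne1 ne2; have [Gs Gi] := sG.
have neq y z : G y z -> y != z by apply: contraTneq => ->; rewrite Gi.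
have conclude (ps : seq (seq 'I_n)) : {in ps, forall p, sorted G p /\ p != [::]} ->
    uniq (flatten ps) -> {subset flatten ps <= [:: a; b; c; d]} ->
    0 < size ps <= 2 -> size (flatten ps) = size ps + 2 -> False.
  move=> pP up sub sp sf.
  have sX : {subset flatten ps <= ~: X}.
    by move=> y /sub; rewrite !(inE, in_setC) => /or4P[] /eqP ->; rewrite -?in_setC.
  have [|v [ys [vX [sy uy] yX g0]]] := @rich_hub X k.-1 (flatten ps) tX sX rX.
    by rewrite sf; move: sp; clear; lia.
  apply: (@no_hub_with_segments X v ys ps) => //.
  - by rewrite sy; move: sp k4 k5; clear; lia.
  - by move=> y r yy rr; rewrite Gs; apply: g0.
  - by rewrite sy; move: sp k4 k5; clear; lia.
  - by rewrite sf sy; move: sp k4; clear; lia.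
have path3 y z w : G y z -> G z w -> y != w ->
    {subset [:: y; z; w] <= [:: a; b; c; d]} -> False.
  move=> yz zw yw sub; apply: (conclude [:: [:: y; z; w]]) => //=.
  - by move=> p; rewrite inE => /eqP ->; rewrite /= yz zw.
  - by rewrite !inE negb_or yw !neq.
have ba := ab; rewrite Gs in ba; have dc := cd; rewrite Gs in dc.
have sub3 (y z w : 'I_n) : y \in [:: a; b; c; d] -> z \in [:: a; b; c; d] ->
    w \in [:: a; b; c; d] -> {subset [:: y; z; w] <= [:: a; b; c; d]}.
  by move=> h1 h2 h3 u uy; rewrite !inE in uy; case/or3P: uy => /eqP ->.
have am : a \in [:: a; b; c; d] by rewrite !inE eqxx.
have bm : b \in [:: a; b; c; d] by rewrite !inE eqxx orbT.
have cm : c \in [:: a; b; c; d] by rewrite !inE eqxx !orbT.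
have dm : d \in [:: a; b; c; d] by rewrite !inE eqxx !orbT.
have [ac|ac] := eqVneq a c.
  apply: (@path3 b a d) => //; [by rewrite ac | | exact: sub3].
  by move: ne1; rewrite ac eqxx /= => ->.
have [ad|ad] := eqVneq a d.
  apply: (@path3 b a c) => //; [by rewrite ad | | exact: sub3].
  by move: ne2; rewrite ad eqxx /= => ->.
have [bc|bc] := eqVneq b c.
  by apply: (@path3 a b d) => //; [rewrite bc | exact: sub3].
have [bd|bd] := eqVneq b d.
  by apply: (@path3 a b c) => //; [rewrite bd | exact: sub3].
apply: (conclude [:: [:: a; b]; [:: c; d]]) => //=.
- by move=> p; rewrite !inE => /orP[] /eqP ->; rewrite /= ?ab ?cd.
- by rewrite !inE !negb_or ac ad bc bd !neq.
Qed.
End TightSplit.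

(** * Summing the eigenvalue equation over the two sides *)

Local Open Scope ring_scope.

Lemma handshake n (G : rel 'I_n) (Y : {set 'I_n}) : simple_graph G ->
  (\sum_(v in Y) #|nbr G v :&: Y| = 2 * edges_in G Y)%N.
Proof.
move=> [Gs Gi].
pose P := [set e : 'I_n * 'I_n | [&& e.1 \in Y, e.2 \in Y & G e.1 e.2]].
pose Lt := [set e : 'I_n * 'I_n | (e.1 < e.2)%N].
pose swap (e : 'I_n * 'I_n) := (e.2, e.1).
have -> : (\sum_(v in Y) #|nbr G v :&: Y| = #|P|)%N.
  rewrite -sum1_card (eq_bigr (fun v => \sum_(w | [&& v \in Y, w \in Y & G v w]) 1)%N).
    rewrite pair_big_dep /=; apply: eq_bigl => e; rewrite inE.
    by case: (e.1 \in Y).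
  move=> v vY; rewrite sum1dep_card; apply: eq_card => w.
  by rewrite !inE vY andbC.
have E : P :&: Lt = [set e : 'I_n * 'I_n | (e.1 \in Y) && (e.2 \in Y) && G e.1 e.2 && (e.1 < e.2)%N].
  by apply/setP => e; rewrite !inE -!andbA.
rewrite -(cardsID Lt P) /edges_in -E mul2n -addnn; congr (_ + _)%N.
have swapI : injective swap by move=> [a b] [c e] [-> ->].
rewrite -[RHS](card_imset _ swapI); apply: eq_card => e.
apply/idP/imsetP => [|[[a b] + ->]].
  rewrite !inE -leqNgt => /andP[le /and3P[e1 e2 e12]]; exists (swap e).
    rewrite !inE /= e1 e2 Gs e12 /= ltn_neqAle le andbT.
    by apply: contraTneq e12 => /val_inj ->; rewrite Gi.
  by case: (e).
rewrite !inE /= => /andP[/and3P[aY bY ab] lt].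
by rewrite Gs ab aY bY -leqNgt ltnW.
Qed.

Lemma near_half_bounds (R : realType) n l : near_half n l ->
  n%:R <= 2 * l%:R + 1 :> R /\ 2 * l%:R <= n%:R + 2 :> R.
Proof.
by move=> lh; split; rewrite -natrM ?natr1 -?natrD ler_nat; case: lh => ->; lia.
Qed.

Lemma near_half_le n l : (0 < n)%N -> near_half n l -> (l <= n)%N.
Proof. by move=> n0 lh; case: lh => ->; lia. Qed.

Lemma near_half_mul (R : realType) n l : (0 < n)%N -> near_half n l ->
  n%:R ^+ 2 / 4 - 1 <= l%:R * (n - l)%:R :> R.
Proof.
move=> n0 lh; have [h1 h2] := near_half_bounds R lh.
have ln := near_half_le n0 lh.
rewrite natrB //; have : (n%:R - 2 * l%:R) ^+ 2 <= 4 :> R by nra.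
nra.
Qed.

Section Balance.
Variables (R : realType) (k n : nat) (G : rel 'I_n) (x : 'I_n -> R).
Implicit Types X : {set 'I_n}.
Let lam := lambda1 R G.
Let nr : R := n%:R.
Let d : R := k.-1%:R.
Local Notation rc := (rcard R).
Local Notation N := (nbr G).
Hypotheses (k45 : (k = 4 \/ k = 5)%N).
Hypotheses (sG : simple_graph G) (fG : Defs.free (@wheel (2 * k + 1)) G).
Hypotheses (n_large : 10 * 400 <= nr).
Hypotheses (lam_lo : nr / 2 <= lam) (lam_hi : lam <= nr / 2 + nr / 400).
Hypotheses (x1 : forall i, x i <= 1) (xlo : forall i, 39 / 40 <= x i).
Hypothesis ev : forall i, adj_sum G x i = lam * x i.
Variable l : nat.
Hypothesis lam_gain : l%:R * (n - l)%:R + 198 / 100 <= lam ^+ 2 - d * lam.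
Hypothesis l_half : near_half n l.

Definition balanced (X : {set 'I_n}) := [/\ tight G k X,
  nr / 2 - 2 * nr / 400 <= rc X & nr / 2 - 2 * nr / 400 <= rc (~: X)].

Lemma balancedC X : balanced X -> balanced (~: X).
Proof. by case=> /tightC tX h1 h2; split; rewrite ?setCK. Qed.

Definition mass (X : {set 'I_n}) : R := \sum_(v in X) x v.
Definition inner_mass (X : {set 'I_n}) : R := \sum_(v in X) rc (N v :&: X) * x v.
(** The weight that [X] fails to receive from the other side, compared with a complete join. *)
Definition missing_mass (X : {set 'I_n}) : R :=
  \sum_(w in ~: X) rc (X :\: N w) * x w.

Let k4 : (4 <= k)%N. Proof. by case: k45 => ->. Qed.
Let k5 : (k <= 5)%N. Proof. by case: k45 => ->. Qed.
Let d3 : 3 <= d. Proof. by rewrite /d ler_nat; case: k45 => ->. Qed.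
Let d4 : d <= 4. Proof. by rewrite /d ler_nat; case: k45 => ->. Qed.
Let x0 i : 0 <= x i. Proof. by apply: le_trans (xlo i); lra. Qed.

Let n_pos : (0 < n)%N.
Proof. by rewrite -(ltr0n R) -/nr; have := n_large; lra. Qed.

Ltac facts := have nl := n_large; have ll := lam_lo; have lh := lam_hi;
  have dl := d3; have dh := d4.

(** Sum the eigenvalue equation over [X] and exchange sums: [w] outside [X] counts once for each of
    its neighbours in [X]. *)
Lemma mass_eq X :
  lam * mass X = inner_mass X + rc X * mass (~: X) - missing_mass X.
Proof.
have [Gs _] := sG.
rewrite /mass mulr_sumr; under eq_bigr => v _ do rewrite -ev adj_sumE (sum_setID _ X).
rewrite big_split /= -addrA; congr (_ + _).
  rewrite (exchange_big_dep (mem X)) /=; last by move=> v w _; rewrite !inE => /andP[].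
  apply: eq_bigr => w wX; rewrite rcardE mulr_suml.
  apply: eq_big => [v|v _]; last by rewrite mul1r.
  by rewrite !inE wX Gs andbT andbC.
rewrite (exchange_big_dep (mem (~: X))) /=; last by move=> v w _; rewrite !inE => /andP[].
rewrite mulr_sumr -sumrB; apply: eq_bigr => w wX.
rewrite (rcardID R X (N w)) mulrDl addrK rcardE mulr_suml.
apply: eq_big => [v|v _]; last by rewrite mul1r.
by move: wX; rewrite !inE => ->; rewrite Gs.
Qed.

Lemma mass_ge X : 39 / 40 * rc X <= mass X.
Proof. by apply: sum_ge_rcard => v _; apply: xlo. Qed.

Lemma missing_mass_ge0 X : 0 <= missing_mass X.
Proof. by apply: sumr_ge0 => v _; rewrite mulr_ge0 ?rcard_ge0. Qed.

Lemma rc_mul_le (X : {set 'I_n}) : rc X * rc (~: X) <= nr ^+ 2 / 4.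
Proof. have := rc_n R X; have := sqr_ge0 (rc X - rc (~: X)); rewrite -/nr; nra. Qed.

(** Dropping the missing terms and multiplying the two mass equations gives [(lam - a) (lam - b) <=
    |X| |~: X| <= n^2/4], while [a + b <= d] and the gain put the left side above [n^2/4]. *)
Lemma inner_density_bound X a b : balanced X -> 0 <= a -> 0 <= b -> a + b <= d ->
  inner_mass X <= a * mass X -> inner_mass (~: X) <= b * mass (~: X) -> False.
Proof.
facts; move=> [_ sX sX'] a0 b0 abd hX hX'.
have e1 := mass_eq X; have e2 := mass_eq (~: X); rewrite setCK in e2.
have m1 := missing_mass_ge0 X; have m2 := missing_mass_ge0 (~: X).
have g1 := mass_ge X; have g2 := mass_ge (~: X).
have p1 : 0 < mass X by lra.
have p2 : 0 < mass (~: X) by lra.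
have i1 : (lam - a) * mass X <= rc X * mass (~: X) by lra.
have i2 : (lam - b) * mass (~: X) <= rc (~: X) * mass X by lra.
have i3 : (lam - a) * (lam - b) * (mass X * mass (~: X)) <=
    rc X * rc (~: X) * (mass X * mass (~: X)).
  have -> : (lam - a) * (lam - b) * (mass X * mass (~: X)) =
      ((lam - a) * mass X) * ((lam - b) * mass (~: X)) by ring.
  have -> : rc X * rc (~: X) * (mass X * mass (~: X)) =
      (rc X * mass (~: X)) * (rc (~: X) * mass X) by ring.
  by apply: ler_pM => //; apply: mulr_ge0; lra.
rewrite ler_pM2r ?mulr_gt0 // in i3.
have := rc_mul_le X; have := near_half_mul R n_pos l_half; rewrite -/nr; have := lam_gain; nra.
Qed.

Lemma inner_mass_exact X (a : nat) : {in X, forall v, (#|N v :&: X| <= a)%N} ->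
  inner_mass X <= a%:R * mass X.
Proof.
move=> h; rewrite /inner_mass /mass mulr_sumr; apply: ler_sum => v vX.
by rewrite ler_wpM2r // /rcard ler_nat h.
Qed.

(** Fewer than 200 vertices exceed degree [a], each by at most 4. The extra 800 is below half of
    [mass X] since [n >= 4000]. *)
Lemma inner_mass_few X (a : nat) : balanced X -> ~~ rich G X a.+1 ->
  inner_mass X <= (a%:R + 1 / 2) * mass X.
Proof.
facts; move=> [[_ _ tX _] sX _]; rewrite /rich -ltnNge => few.
have h : inner_mass X <= a%:R * mass X + 4 * rc (deg_ge G X a.+1).
  have -> : rc (deg_ge G X a.+1) = \sum_(v in X) (v \in deg_ge G X a.+1)%:R.
    rewrite rcardE big_mkcond [RHS]big_mkcond; apply: eq_bigr => v _.
    by rewrite inE; case: (v \in X) => //=; case: ifP.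
  rewrite /inner_mass /mass !mulr_sumr -big_split /=; apply: ler_sum => v vX.
  rewrite inE vX /=; case: (ltnP a #|N v :&: X|) => dv /=.
    have : rc (N v :&: X) <= 4.
      by rewrite (ler_nat R _ 4); have [dv' _] := tX v vX; apply: leq_trans dv' _; case: k45 => ->.
    have := rcard_ge0 R (N v :&: X); have := x0 v; have := x1 v.
    have := ler0n R a; nra.
  by rewrite mulr0 addr0 ler_wpM2r // /rcard ler_nat.
have : rc (deg_ge G X a.+1) <= 200 by rewrite (ler_nat R _ 200) ltnW.
have := mass_ge X; lra.
Qed.

(** Every case ends with inner densities summing to [d]. For [k = 4] they are (2,1), (1,2) or
    (3/2,3/2); for [k = 5] they are (3,1), (1,3), (2,2), (5/2,3/2) or (3/2,5/2). *)
Lemma not_both_rich X : balanced X -> rich G X 1 -> rich G (~: X) 1 -> False.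
Proof.
move=> bX r1 r1'; have [tX _ _] := bX.
have bX' := balancedC bX; have [tX' _ _] := bX'.
have dX v : v \in X -> (#|N v :&: X| <= k.-2)%N.
  move=> vX; have [+|] := leqP k.-1 #|N v :&: X|.
    by move=> h; case: (no_full_degree sG fG k4 k5 tX r1' vX h).
  by case: k45 => -> /=.
have dX' v : v \in ~: X -> (#|N v :&: ~: X| <= k.-2)%N.
  move=> vX; have [+|] := leqP k.-1 #|N v :&: ~: X|.
    by move=> h; case: (no_full_degree sG fG k4 k5 tX' _ vX h); rewrite setCK.
  by case: k45 => -> /=.
have side (Y : {set 'I_n}) j : (forall v, v \in Y -> j < #|N v :&: Y| -> False)%N ->
    {in Y, forall v, (#|N v :&: Y| <= j)%N}.
  by move=> h v vY; rewrite leqNgt; apply/negP => /(h v vY).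
(* The slacks [e] and [f] are 0 for a degree bound at every vertex, and 1/2 when [inner_mass_few]
   absorbs the exceptions. *)
have close (a b : nat) (e f : R) : 0 <= e -> 0 <= f -> a%:R + b%:R + e + f <= d ->
    inner_mass X <= (a%:R + e) * mass X ->
    inner_mass (~: X) <= (b%:R + f) * mass (~: X) -> False.
  move=> e0 f0 abd; apply: inner_density_bound => //; last by lra.
    by rewrite addr_ge0.
  by rewrite addr_ge0.
have half0 : 0 <= 1 / 2 :> R by lra.
have exactX a : {in X, forall v, (#|N v :&: X| <= a)%N} ->
    inner_mass X <= (a%:R + 0) * mass X.
  by rewrite addr0; apply: inner_mass_exact.
have exactX' a : {in ~: X, forall v, (#|N v :&: ~: X| <= a)%N} ->
    inner_mass (~: X) <= (a%:R + 0) * mass (~: X).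
  by rewrite addr0; apply: inner_mass_exact.
case: (k45) => kE.
- have dE : d = 3 by rewrite /d kE.
  rewrite kE /= in dX dX'.
  have [r2|r2] := boolP (rich G X 2).
    apply: (close 2 1 0 0) => //; [lra|exact: exactX|apply/exactX'/side].
    by move=> v vX h; apply: (no_degree_rich2 sG fG k4 k5 tX' _ vX); rewrite ?setCK ?kE.
  have [r2'|r2'] := boolP (rich G (~: X) 2).
    apply: (close 1 2 0 0) => //; [lra|apply/exactX/side|exact: exactX'].
    by move=> v vX h; apply: (no_degree_rich2 sG fG k4 k5 tX r2' vX); rewrite kE.
  apply: (close 1 1 (1/2) (1/2)) => //; [lra|exact: inner_mass_few|].
  exact: inner_mass_few.
have dE : d = 4 by rewrite /d kE.
rewrite kE /= in dX dX'.
have [r3|r3] := boolP (rich G X 3).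
  apply: (close 3 1 0 0) => //; [lra|exact: exactX|apply/exactX'/side].
  by move=> v vX; apply: (no_rich3_degree2 sG fG k4 k5 kE tX r3 r1' vX).
have [r3'|r3'] := boolP (rich G (~: X) 3).
  apply: (close 1 3 0 0) => //; [lra|apply/exactX/side|exact: exactX'].
  move=> v vX.
  by have := @no_rich3_degree2 _ _ _ sG fG k4 k5 (~: X) v kE tX' r3'; rewrite setCK; apply.
have [r2|r2] := boolP (rich G X 2).
  have dX'2 : {in ~: X, forall v, (#|N v :&: ~: X| <= 2)%N}.
    by apply: side => v vX h; apply: (no_degree_rich2 sG fG k4 k5 tX' _ vX); rewrite ?setCK ?kE.
  have [r2'|r2'] := boolP (rich G (~: X) 2).
    apply: (close 2 2 0 0) => //; [lra|apply/exactX/side|exact: exactX'].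
    by move=> v vX h; apply: (no_degree_rich2 sG fG k4 k5 tX r2' vX); rewrite kE.
  by apply: (close 2 1 (1/2) (1/2)) => //; [lra|exact: inner_mass_few|exact: inner_mass_few].
by apply: (close 1 2 (1/2) (1/2)) => //; [lra|exact: inner_mass_few|exact: inner_mass_few].
Qed.

(** * One side with few edges *)

Definition degree_deficit X : nat := (\sum_(v in X) (k.-1 - #|N v :&: X|))%N.
Definition missing_count X : nat := (\sum_(v in ~: X) #|X :\: N v|)%N.

Lemma degree_deficit_mass X : balanced X ->
  39 / 40 * (degree_deficit X)%:R <= d * mass X - inner_mass X.
Proof.
move=> [[_ _ tX _] _ _]; rewrite /degree_deficit natr_sum mulr_sumr.
rewrite /mass mulr_sumr /inner_mass -sumrB; apply: ler_sum => v vX.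
have [dv _] := tX v vX; rewrite natrB // -/d -/(rc _) -mulrBl mulrC.
by apply: ler_wpM2l (xlo v); rewrite subr_ge0 /rcard ler_nat.
Qed.

Lemma missing_count_mass X : 39 / 40 * (missing_count X)%:R <= missing_mass X.
Proof.
rewrite /missing_count natr_sum mulr_sumr; apply: ler_sum => v _.
by rewrite mulrC -/(rc _) ler_wpM2l ?rcard_ge0.
Qed.

(** Eliminates [mass (~: X)] between the two mass equations. The spectral gain, the degree deficit
    and the missing pairs are all paid for by the edges inside [~: X]. *)
Lemma master_identity X :
  (lam ^+ 2 - d * lam - rc X * rc (~: X)) * mass X
  + lam * (d * mass X - inner_mass X + missing_mass X)
  + rc X * missing_mass (~: X) = rc X * inner_mass (~: X).
Proof.
have e1 := mass_eq X; have e2 := mass_eq (~: X); rewrite setCK in e2.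
have -> : inner_mass X = lam * mass X - rc X * mass (~: X) + missing_mass X.
  by rewrite e1; ring.
have -> : inner_mass (~: X) =
    lam * mass (~: X) - rc (~: X) * mass X + missing_mass (~: X).
  by rewrite e2; ring.
by ring.
Qed.

Lemma part_upper X : balanced X -> rc X <= nr / 2 + 2 * nr / 400.
Proof. by move=> [_ _ sX]; have := rc_n R X; rewrite -/nr; lra. Qed.

(** The inner mass of [~: X] is at most 800, so [master_identity] bounds the degree deficit of [X]
    by a constant and most vertices of [X] have full degree. *)
Lemma rich_other_side X : balanced X -> ~~ rich G (~: X) 1 -> rich G X k.-1.
Proof.
facts; move=> bX nr1; have [[_ _ tX tX'] sX sX'] := bX.
have [d0 m0] : 0 <= d /\ 0 <= lam by split; lra.
have im : inner_mass (~: X) <= 800.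
  apply: le_trans (_ : 4 * rc (deg_ge G (~: X) 1) <= _); last first.
    have : rc (deg_ge G (~: X) 1) <= 200.
      by rewrite (ler_nat R _ 200); move: nr1; rewrite /rich -ltnNge => /ltnW.
    by lra.
  rewrite rcardE mulr_sumr big_mkcond /inner_mass [X in X <= _]big_mkcond /=.
  apply: ler_sum => v _; rewrite [v \in deg_ge _ _ _]inE.
  case: (boolP (v \in ~: X)) => //= vX.
  rewrite mulr1 /rcard.
  have [dv _] := tX' v vX.
  have {}dv : #|N v :&: ~: X|%:R <= 4 :> R.
    by rewrite (ler_nat R _ 4); apply: leq_trans dv _; case: k45 => ->.
  case: (posnP #|N v :&: ~: X|) => [->|_]; first by rewrite mul0r.
  have := ler0n R #|N v :&: ~: X|; have := x0 v; have := x1 v; nra.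
have id := master_identity X.
have gX := mass_ge X; have dm := degree_deficit_mass bX.
have mm := missing_mass_ge0 X; have mm' := missing_mass_ge0 (~: X).
have pX := part_upper bX.
have pos : 0 <= (lam ^+ 2 - d * lam - rc X * rc (~: X)) * mass X.
  apply: mulr_ge0; last by lra.
  have := rc_mul_le X; have := near_half_mul R n_pos l_half; rewrite -/nr; have := lam_gain; lra.
have rX0 : 0 <= rc X by lra.
have h1 : lam * (d * mass X - inner_mass X) <= rc X * 800.
  have h2 : rc X * inner_mass (~: X) <= rc X * 800 by rewrite ler_wpM2l.
  have h3 := mulr_ge0 rX0 mm'; have h4 := mulr_ge0 m0 mm.
  by rewrite mulrDr in id; lra.
(* The factor comes from [|X| <= n/2 + 2n/400 <= (101/100) lam]. *)
have h5 : d * mass X - inner_mass X <= 800 * (101 / 100).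
  have lp : 0 < lam by lra.
  by rewrite -(ler_pM2l lp); apply: le_trans h1 _; lra.
have low : rc (X :\: deg_ge G X k.-1) <= (degree_deficit X)%:R.
  rewrite rcardE /degree_deficit natr_sum big_mkcond [X in _ <= X]big_mkcond /=.
  apply: ler_sum => v _; rewrite !inE; case: (v \in X) => //=; rewrite ?andbT ?andbF //.
  case: (leqP k.-1 #|N v :&: X|) => //= dv.
  by rewrite ler1n subn_gt0.
have ID := rcardID R X (deg_ge G X k.-1).
have sub := rcardS R (subsetIr X (deg_ge G X k.-1)).
rewrite /rich -(ler_nat R) -/(rc _); lra.
Qed.

Lemma few_edges X : balanced X -> ~~ rich G (~: X) 1 -> (edges_in G (~: X) <= 1)%N.
Proof.
move=> bX nr1; have [tX _ _] := bX; have rX := rich_other_side bX nr1.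
rewrite leqNgt; apply/negP => /card_gt1P [[a b] [[c e]]].
rewrite !inE /= => -[/andP[/andP[/andP[aX bX'] ab] ltab] /andP[/andP[/andP[cX eX] ce] ltce] ne].
apply: (@no_two_edges _ _ _ sG fG k4 k5 X a b c e tX rX) => //.
- by split; rewrite inE.
- by apply: negbTE; move: ne; rewrite xpair_eqE.
apply/negP => /andP[/eqP ae /eqP bc]; move: ltab ltce; rewrite ae bc => h1 h2.
by have := ltn_trans h1 h2; rewrite ltnn.
Qed.

(** With no edge in [~: X] the right side of [master_identity] vanishes against a positive gain.
    With one edge it is at most [2 |X|], and after the gain this leaves room for at most one
    defect. *)
Lemma tight_structure X : balanced X -> ~~ rich G (~: X) 1 ->
  [/\ {in X & ~: X, forall v w, G v w}, (degree_deficit X <= 1)%N,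
     edges_in G (~: X) = 1%N & (l * (n - l) <= #|X| * #|~: X|)%N].
Proof.
facts; move=> bX nr1; have [tX sX sX'] := bX.
have id := master_identity X.
have gX := mass_ge X; have dm := degree_deficit_mass bX.
have mm := missing_count_mass X; have mm' := missing_count_mass (~: X).
have pX := part_upper bX.
have im : inner_mass (~: X) <= 2 * (edges_in G (~: X))%:R.
  rewrite -natrM -handshake // natr_sum; apply: ler_sum => v _.
  by rewrite -/(rc _) -[X in _ <= X]mulr1 ler_wpM2l ?rcard_ge0.
have e1 := few_edges bX nr1.
have gain : 198 / 100 - 1 <= lam ^+ 2 - d * lam - rc X * rc (~: X).
  have := rc_mul_le X; have := near_half_mul R n_pos l_half; rewrite -/nr; have := lam_gain; lra.
have rX0 : 0 < rc X by lra.
have mX0 : 0 < mass X by lra.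
have lam0 : 0 < lam by lra.
have g0 : 0 < (lam ^+ 2 - d * lam - rc X * rc (~: X)) * mass X.
  by apply: mulr_gt0 => //; lra.
have md0 : 0 <= (degree_deficit X)%:R :> R by rewrite ler0n.
have mc0 : 0 <= (missing_count X)%:R :> R by rewrite ler0n.
have mc0' : 0 <= (missing_count (~: X))%:R :> R by rewrite ler0n.
have edge1 : edges_in G (~: X) = 1%N.
  case: (edges_in G (~: X)) e1 im => [|[|//]] _ // im; exfalso.
  have t1 : 0 <= lam * (d * mass X - inner_mass X + missing_mass X).
    by apply: mulr_ge0; lra.
  have t2 : 0 <= rc X * missing_mass (~: X) by apply: mulr_ge0; lra.
  have t3 : rc X * inner_mass (~: X) <= 0 by rewrite pmulr_rle0 //; lra.
  by lra.
rewrite edge1 mulr1 in im.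
pose K : R := (degree_deficit X)%:R + (missing_count X)%:R + (missing_count (~: X))%:R.
(* Divide the identity by [|X|], using [lam >= (100/101) |X|], and then by 39/40:
   [2 * 40/39 <= 206/100] and [99/100 <= 100/101]. *)
have main : (lam ^+ 2 - d * lam - rc X * rc (~: X)) + 99 / 100 * K <= 206 / 100.
  have t1 : rc X * (100 / 101) * (39 / 40 * ((degree_deficit X)%:R + (missing_count X)%:R))
      <= lam * (d * mass X - inner_mass X + missing_mass X).
    by apply: ler_pM; lra.
  have t2 : rc X * (39 / 40 * (missing_count (~: X))%:R) <= rc X * missing_mass (~: X).
    by rewrite ler_pM2l.
  have t3 : rc X * inner_mass (~: X) <= rc X * 2 by rewrite ler_pM2l.
  have t4 : (lam ^+ 2 - d * lam - rc X * rc (~: X)) * (39 / 40 * rc X)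
     <= (lam ^+ 2 - d * lam - rc X * rc (~: X)) * mass X.
    by rewrite ler_pM2l //; lra.
  set T := lam ^+ 2 - _ - _ in id t4 gain *.
  have t5 : rc X * (39 / 40 * T + 100 / 101 * (39 / 40 * ((degree_deficit X)%:R + (missing_count X)%:R))
     + 39 / 40 * (missing_count (~: X))%:R) <= rc X * 2 by lra.
  rewrite ler_pM2l // in t5.
  by rewrite /K; lra.
have K1 : (degree_deficit X + missing_count X + missing_count (~: X) <= 1)%N.
  by rewrite -ltnS -(ltr_nat R) !natrD -/K; lra.
split => //.
(* A missing cross pair is counted from both sides, hence makes two defects. *)
- move=> v w vX wX; apply: contraT => nvw; have [Gs _] := sG.
  have h1 : (0 < missing_count X)%N.
    rewrite /missing_count (bigD1 w) //= addn_gt0; apply/orP; left.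
    by rewrite card_gt0; apply/set0Pn; exists v; rewrite !inE Gs nvw vX.
  have h2 : (0 < missing_count (~: X))%N.
    rewrite /missing_count (bigD1 v) ?setCK //= addn_gt0; apply/orP; left.
    by rewrite card_gt0; apply/set0Pn; exists w; rewrite !inE nvw -in_setC.
  by move: K1 h1 h2; clear; lia.
- by move: K1; clear; lia.
(* The product falls short of [l (n - l)] by at most [206/100 - 198/100 < 1], hence not at all. *)
rewrite -ltnS -(ltr_nat R) -natr1 !natrM -/(rc X) -/(rc (~: X)).
have K0 : 0 <= K by rewrite /K; lra.
have := lam_gain; lra.
Qed.
End Balance.

(** * The theorem *)

(** Hub [w]; the rim is [w'] followed by the path on [2 k - 1] vertices, closed through the complete
    join. *)
Lemma wheel_of_path k n (G : rel 'I_n) (X : {set 'I_n}) w w' : (0 < k)%N ->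
    simple_graph G -> {in X & ~: X, forall v u, G v u} -> w \in ~: X -> w' \in ~: X ->
    G w w' -> contains_in (@path_graph (2 * k - 1)) G X ->
  contains (@wheel (2 * k + 1)) G.
Proof.
move=> k0 sG cX wX wX' ww' [f [finj [fX fE]]]; have [Gs Gi] := sG.
have sz : size (codom f) = (2 * k - 1)%N by rewrite size_codom card_ord.
have inX y : y \in codom f -> y \in X by move=> /codomP [i ->].
have GwX y : y \in X -> G w y by move=> yX; rewrite Gs; apply: cX.
have GwX' y : y \in X -> G w' y by move=> yX; rewrite Gs; apply: cX.
apply: (@wheel_of_cycle n k G sG w (w' :: codom f)).
- by rewrite /= sz; lia.
- rewrite /= inE negb_or; apply/and3P; split.
  + apply/andP; split; first by apply: contraTneq ww' => ->; rewrite Gi.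
    by apply/negP => /inX wX1; move: wX; rewrite inE wX1.
  + by apply/negP => /inX wX1; move: wX'; rewrite inE wX1.
  + by apply/injectiveP.
- have so : sorted G (codom f).
    apply/(sortedP w) => i lt; rewrite sz in lt.
    have lt1 : (i < 2 * k - 1)%N by apply: ltnW.
    have nthE j (lj : (j < 2 * k - 1)%N) : nth w (codom f) j = f (Ordinal lj).
      rewrite codomE (nth_map (Ordinal lj)) ?size_enum_ord //.
      by congr f; apply: val_inj; rewrite /= nth_enum_ord.
    by rewrite !nthE; apply: fE; rewrite /path_graph /= eqxx orbT.
  rewrite /cycle rcons_path; apply/andP; split.
    case E : (codom f) so inX => [//|y p] /= so inX.
    by rewrite so andbT GwX' // inX // mem_head.
  case E : (codom f) sz inX => [|y p] sz inX; first by move: sz => /=; lia.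
  by rewrite /= Gs GwX' // inX // mem_last.
- apply/allP => y; rewrite inE => /orP[/eqP -> //|/inX]; exact: GwX.
Qed.

Lemma in_U_of_deficit k n (G : rel 'I_n) (X : {set 'I_n}) : (1 < k)%N ->
    {in X, forall v, (#|nbr G v :&: X| <= k.-1)%N} -> (degree_deficit k G X <= 1)%N ->
    ~ contains_in (@path_graph (2 * k - 1)) G X ->
  in_U G X k #|X|.
Proof.
move=> k1 + + noP; pose D v := #|nbr G v :&: X|; rewrite -/D => dX.
have {}dX v : v \in X -> (D v <= k.-1)%N by apply: dX.
rewrite /degree_deficit -/(\sum_(v in X) (k.-1 - D v))%N => def.
split=> //; split => //.
have dE x : deg_in G X x = D x.
  by rewrite /deg_in; apply: eq_card => y; rewrite !inE andbC.
have [full|] := boolP [forall x in X, D x == k.-1].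
  by left=> x xX; rewrite dE; apply/eqP; apply: (forall_inP full).
rewrite negb_forall_in => /exists_inP [v vX nv]; right; exists v.
have lt : (D v < k.-1)%N by rewrite ltn_neqAle nv dX.
move: def; rewrite (bigD1 v) //=.
set S := (\sum_(i in X | i != v) _)%N => def.
have S0 : S = 0%N by move: def lt; clear; lia.
split=> //; split; first by rewrite dE; move: def lt S0; clear; lia.
move=> x xX xv; rewrite dE.
have : (k.-1 - D x <= S)%N by rewrite /S (bigD1 x) ?xX //= leq_addr.
by have := dX x xX; rewrite S0; clear; lia.
Qed.

Lemma ge_half_of_gain (R : realType) (nr lam d p : R) : 10 * 400 <= nr -> 3 <= d ->
  0 < lam -> nr ^+ 2 / 4 - 1 <= p -> 0 <= lam * (lam ^+ 2 - d * lam - p) ->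
  nr / 2 <= lam.
Proof.
move=> nl d3 l0 hp; rewrite pmulr_rge0 // => h.
rewrite leNgt; apply/negP => lt.
have h1 : lam * (lam - d) <= lam * (nr / 2 - 3) by rewrite ler_pM2l //; lra.
nra.
Qed.

(** A neighbourhood contains no [K_{k,k}]; the density [1 / N] with [N = 400^2] gives exactly
    [(n/400)^2]. *)
Lemma sparse_nbr (R : realType) k : (1 < k)%N -> exists n1 : nat,
  forall n (G : rel 'I_n) u, (n1 <= n)%N -> simple_graph G ->
    Defs.free (@wheel (2 * k + 1)) G ->
  \sum_(v in nbr G u) rcard R (nbr G v :&: nbr G u) <= (n%:R / 400) ^+ 2.
Proof.
move=> k1; have [N N0 NE] : exists2 N : nat, (0 < N)%N & N%:R = 400 * 400 :> R.
  by exists (400 * 400)%N; rewrite ?muln_gt0 ?natrM.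
exists (4 * N * k * 2 ^ (4 * N * k)).+1 => n G u nlarge sG fG.
have [Gs _] := sG.
have := @Kovari_Sos_Turan 'I_n G (nbr G u) k N n Gs (ltnW k1) N0
  (eq_leq (card_ord n)) nlarge (no_biclique_in_nbr k1 sG fG (u := u)).
rewrite -(ler_nat R) natrM natrX NE natr_sum.
have -> : \sum_(v in nbr G u) #|[set w in nbr G u | G v w]|%:R =
    \sum_(v in nbr G u) rcard R (nbr G v :&: nbr G u).
  by apply: eq_bigr => v _; congr (_%:R); apply: eq_card => w; rewrite !inE andbC.
move=> h; have p : 0 < 400 * 400 :> R by lra.
by rewrite -(ler_pM2l p); apply: le_trans h _; rewrite exprMn; lra.
Qed.

Theorem theorem1p3 (R : realType) (k : nat) :
  (k = 4 \/ k = 5)%N ->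
  exists n0 : nat, forall (n : nat) (G : rel 'I_n), (n0 <= n)%N ->
    SPEX R (@wheel (2 * k + 1)) G ->
    exists (s : R) (L : {set 'I_n}),
      `|s| <= 1 /\
      (#|L|%:R = n%:R / 2 + s) /\ (#|~: L|%:R = n%:R / 2 - s) /\
      (forall x y, x \in L -> y \in ~: L -> G x y) /\
      (exists m : nat, m%:R = n%:R / 2 + s /\ in_U G L k m) /\
      edges_in G (~: L) = 1%N.
Proof.
move=> k45.
have k4 : (4 <= k)%N by case: k45 => ->.
have k5 : (k <= 5)%N by case: k45 => ->.
have k2 : (2 <= k)%N by apply: leq_trans k4.
have [n1 n1P] := sparse_nbr R k2.
exists (n1 + 10 * 400)%N => n G n0n spex.
have n1n : (n1 <= n)%N by apply: leq_trans n0n; apply: leq_addr.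
have nl : 10 * 400 <= n%:R :> R.
  by rewrite -natrM ler_nat; apply: leq_trans n0n; apply: leq_addl.
have n100 : (100 <= n)%N by rewrite -(ler_nat R); lra.
have n_pos : (0 < n)%N by apply: leq_trans n100.
have [sG [fG maxG]] := spex.
have [lam0 [l [lh lb]]] := lambda1_lower_bound k45 n100 spex.
set lam := lambda1 R G in lam0 lb maxG.
have d3 : 3 <= k.-1%:R :> R by rewrite ler_nat; case: (k45) => ->.
have lp := near_half_mul R n_pos lh.
have ll : n%:R / 2 <= lam.
  apply: (ge_half_of_gain nl d3 lam0 lp); apply: le_trans lb.
  by rewrite mulr_ge0.
have [x [x0 x1 [u xu] ev]] := perron R sG n_pos.
have sp := n1P n G u n1n sG fG.
have hi : lam <= n%:R / 2 + n%:R / 400.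
  exact: (lam_hi k5 sG nl ll x0 x1 ev xu sp).
have xlo v : 39 / 40 <= x v.
  have [_ h] := x_lower k2 k5 sG fG maxG nl ll x0 x1 ev xu sp v.
  by apply: le_trans h; lra.
have [X aX] := almost_complete_exists k2 k5 sG fG maxG nl ll x0 x1 ev xu sp.
(* The gain is [2 l / lam], where [2 l >= n - 1] and [lam <= n/2 + n/400]. *)
have gain : l%:R * (n - l)%:R + 198 / 100 <= lam ^+ 2 - k.-1%:R * lam.
  have [l2 _] := near_half_bounds R lh.
  have : lam * (198 / 100) <= lam * (lam ^+ 2 - k.-1%:R * lam - l%:R * (n - l)%:R).
    by apply: le_trans lb; lra.
  by rewrite ler_pM2l //; lra.
have xlo' v : 1 - 10 / 400 <= x v by apply: le_trans (xlo v); lra.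
have side (Y : {set 'I_n}) : almost_complete R G Y -> (100 <= #|Y|)%N /\
    {in Y, forall v, #|nbr G v :&: Y| <= k.-1 /\ #|~: Y :\: nbr G v| <= k.-1}%N.
  move=> aY; split=> [|v vY].
    by case: aY => h _ _ _; rewrite -(ler_nat R) -/(rcard R Y); lra.
  have h1 := inner_degree_le k2 k5 sG fG nl ll aY vY; split => //.
  exact: leq_trans (missing_le k2 k5 sG fG maxG nl ll x0 x1 ev aY xlo' vY) h1.
have bX : balanced R k G X.
  have [c1 t1] := side X aX; have [c2 t2] := side _ (almost_completeC aX).
  by rewrite setCK in t2; case: (aX) => h1 h2 _ _; split.
suff conclude (L : {set 'I_n}) : balanced R k G L -> ~~ rich G (~: L) 1 ->
    exists s : R,
      `|s| <= 1 /\
      (#|L|%:R = n%:R / 2 + s) /\ (#|~: L|%:R = n%:R / 2 - s) /\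
      (forall x y, x \in L -> y \in ~: L -> G x y) /\
      (exists m : nat, m%:R = n%:R / 2 + s /\ in_U G L k m) /\
      edges_in G (~: L) = 1%N.
  (* The sides cannot both be rich, so one of them can serve as the complement of [L]. *)
  have [r1|r1] := boolP (rich G (~: X) 1); last first.
    by have [s Hs] := conclude X bX r1; exists s, X.
  have [r2|r2] := boolP (rich G X 1).
    by case: (not_both_rich k45 sG fG nl ll hi x1 xlo ev gain lh bX r2 r1).
  have [|s Hs] := conclude (~: X) (balancedC bX); first by rewrite setCK.
  by exists s, (~: X).
move=> bL nr1; have [[_ _ tL _] _ _] := bL.
have [cL dL eL lL] := tight_structure k45 sG fG nl ll hi x1 xlo ev gain lh bL nr1.
have cn : #|L|%:R + #|~: L|%:R = n%:R :> R := rc_n R L.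
exists (#|L|%:R - n%:R / 2).
have sE : #|L|%:R = n%:R / 2 + (#|L|%:R - n%:R / 2) :> R by ring.
split; [|split; [exact: sE|split; [|split; [|split]]]] => //.
(* [l (n - l) <= |L| |~: L|] says that [|L|] is no farther from [n/2] than [l], which is within
   1. *)
- have ln := near_half_le n_pos lh.
  have [l2 l3] := near_half_bounds R lh.
  move: lL; rewrite -(ler_nat R) !natrM natrB //.
  have -> : #|~: L|%:R = n%:R - #|L|%:R :> R.
    by rewrite -cn addrAC subrr add0r.
  move=> h; rewrite -(@ler_pXn2r R 2) ?nnegrE // real_normK ?num_real // expr1n.
  have : (n%:R - 2 * l%:R) ^+ 2 <= 4 :> R by nra.
  nra.
- have -> : #|~: L|%:R = n%:R - #|L|%:R :> R by rewrite -cn addrAC subrr add0r.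
  by field.
exists #|L|; split => //; apply: in_U_of_deficit => //.
  by move=> v /tL[].
move=> hp; apply: fG.
have [[w w']] : exists e, e \in [set e : 'I_n * 'I_n |
    (e.1 \in ~: L) && (e.2 \in ~: L) && G e.1 e.2 && (e.1 < e.2)%N].
  by apply/set0Pn; rewrite -card_gt0 -/(edges_in _ _) eL.
rewrite !inE /= => /andP[/andP[/andP[wL wL'] ww'] _].
by apply: (wheel_of_path (ltnW k2) sG cL _ _ ww' hp); rewrite inE.
Qed.
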